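(* The functor $\pi_s^-:\mathbb S\mathrm{Bim}(\mathfrak h,I_2(m))\to\mathbb S\mathrm{Bim}(\mathfrak h,\langle t\rangle)$ is represented by the object $B_t(-1)$; that is, $\pi_s^-(M)\cong\mathrm{Hom}_{R^e}(B_t(-1),M)=\mathrm{Hom}_{R^e}(B_t,M)(1)$ as graded $R$-bimodules, naturally in $M\in\mathbb S\mathrm{Bim}(\mathfrak h,I_2(m))$.
   Context: Setting. Let $m\ge 2$ be an integer, $I_2(m)=\langle s,t\mid s^2=t^2=(st)^m=e\rangle$ the dihedral group. Let $\mathbf k$ be a commutative ring of characteristic $0$ and $\mathfrak h=(V,\{\alpha_s,\alpha_t\}\subset V^*,\{\alpha_s^\vee,\alpha_t^\vee\}\subset V)$ a symmetric realization: $V$ is a free $\mathbf k$-module of finite rank, $\langle\alpha_u^\vee,\alpha_u\rangle=2$ for $u\in\{s,t\}$, $a_{st}:=\langle\alpha_s^\vee,\alpha_t\rangle=a_{ts}$, the formulas $u(v)=v-\langle v,\alpha_u\rangle\alpha_u^\vee$ define a representation of $I_2(m)$ on $V$, and $a_{st}=-(q+q^{-1})$ for some $q\in\mathbf k$ with $[m]_q=0$, where $[k]_q=q^{k-1}+q^{k-3}+\dots+q^{1-k}$. Standing assumptions: $\alpha_s,\alpha_t$ are linearly independent; there exist fundamental weights $\rho_s,\rho_t\in V^*$ with $\langle\rho_u,\alpha_v^\vee\rangle=\delta_{uv}$ (fixed once and for all); $[k]_q$ is invertible in $\mathbf k$ for $1\le k<m$; and $q$ is a primitive $2m$-th root of unity.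 $R=\mathrm{Sym}^\bullet(V^* )$, graded with $V^*$ in degree $2$; $R^e=R\otimes_{\mathbf k}R$; graded $R^e$-modules are graded $R$-bimodules. Grading shift: $M(1)_d=M_{d+1}$. For $u\in\{s,t\}$, $B_u=R\otimes_{R^u}R(1)$. $\mathbb S\mathrm{Bim}(\mathfrak h,I_2(m))$ (resp. $\mathbb S\mathrm{Bim}(\mathfrak h,\langle t\rangle)$) is the full, additive, graded, monoidal (under $\otimes_R$), idempotent complete subcategory of graded $R$-bimodules generated by $B_s,B_t$ (resp. by $B_t$). For $M\in\mathbb S\mathrm{Bim}(\mathfrak h,I_2(m))$, $\pi_s^-(M)$ is the kernel of the action of $\rho_s\otimes1-1\otimes\rho_s\in R^e$ on $M$, as a graded sub-bimodule of $M$ (no additional shift). $\mathrm{Hom}_{R^e}(M,N)$ denotes bimodule homomorphisms of all internal degrees, $\bigoplus_n\mathrm{Hom}_{R^e\text{-gmod}}(M,N(n))$, viewed as a graded $R$-bimodule by $(r\cdot f\cdot r')(b)=r\,f(b)\,r'$. *)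

(* Defs.v *)
From HB Require Import structures.
From mathcomp Require Import all_boot all_order all_algebra.
From mathcomp Require Import generic_quotient.
From mathcomp Require Import boolp functions.
From mathcomp Require Import ssrcomplements freeg mpoly.

Set Implicit Arguments.
Unset Strict Implicit.
Unset Printing Implicit Defensive.

Import GRing.Theory.
Local Open Scope ring_scope.
Local Open Scope quotient_scope.

#[local] Obligation Tactic := (intros; simpl).

Section PolyGrading.
Context {k : comNzRingType} {n : nat}.
Implicit Types (a b : {mpoly k[n]}) (d e : int).

(* The grading of R = k[x_1, ..., x_n] with the variables in degree 2; the     *)
(* zero polynomial lies in every degree.                                      *)
Definition rdeg d a : Prop := {in msupp a, forall m, (2 * mdeg m)%:Z = d}.

Lemma rdeg_homog j a : a \is j.-homog -> rdeg (2 * j)%:Z a.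
Proof. by move=> /dhomogP h m /h /= ->. Qed.

Lemma rdeg_split a : exists l : seq {mpoly k[n]},
  (forall b, b \in l -> exists d, rdeg d b) /\ a = \sum_(b <- l) b.
Proof.
exists [seq pihomog mdeg j a | j <- iota 0 (msize a)]; split.
  by move=> b /mapP[j _ ->]; exists (2 * j)%:Z; apply/rdeg_homog/pihomogP.
rewrite big_map {1}(@pihomog_partitionE _ _ mdeg (msize a) a) //.
by rewrite -(big_mkord xpredT (fun i => pihomog mdeg i a)) /index_iota subn0.
Qed.

Lemma rdegB d a b : rdeg d a -> rdeg d b -> rdeg d (a - b).
Proof.
move=> ha hb m hm; have := msuppB_le hm.
by rewrite mem_cat => /orP[/ha|/hb].
Qed.

Lemma rdeg0 d : rdeg d 0.
Proof. by move=> m; rewrite msupp0. Qed.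

Lemma rdegM d e a b : rdeg d a -> rdeg e b -> rdeg (d + e) (a * b).
Proof.
move=> ha hb m /msuppM_le /allpairsP[[m1 m2] /= [h1 h2 ->]].
by rewrite -(ha _ h1) -(hb _ h2) mdegD mulnDr PoszD.
Qed.

Lemma rdeg_sum0 (D : seq int) (c : int -> {mpoly k[n]}) : uniq D ->
  (forall d, rdeg d (c d)) -> \sum_(d <- D) c d = 0 ->
  forall d, d \in D -> c d = 0.
Proof.
move=> uD hc h d dD; apply/mpolyP => m; rewrite mcoeff0.
have [hm|hm] := boolP (m \in msupp (c d)); last by apply: memN_msupp_eq0.
move: (congr1 (mcoeff m) h); rewrite raddf_sum mcoeff0 /=.
rewrite (bigD1_seq d) //= big1 ?addr0 // => e ne.
apply: memN_msupp_eq0; apply: contra ne => hm'.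
by rewrite -(hc _ _ hm) -(hc _ _ hm').
Qed.

End PolyGrading.

Section Bimodules.
Context {k : comNzRingType} {n : nat}.
Local Notation R := {mpoly k[n]}.
Implicit Types (a b : R) (d e : int).

(* Graded R-bimodules on which k acts symmetrically, that is, graded modules  *)
(* over R (x)_k R. The module structure is the left action, ract is the right *)
(* action, and gdeg d is the homogeneous part of degree d.                    *)
Record gbimod := GBimod {
  gcar :> lmodType R;
  ract : gcar -> R -> gcar;
  gdeg : int -> gcar -> Prop;
  ractDl : forall x y a, ract (x + y) a = ract x a + ract y a;
  ractDr : forall x a b, ract x (a + b) = ract x a + ract x b;
  ract1 : forall x, ract x 1 = x;
  ractM : forall x a b, ract x (a * b) = ract (ract x a) b;
  lractA : forall a x b, a *: ract x b = ract (a *: x) b;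
  ractC : forall x (c : k), ract x c%:MP = c%:MP *: x;
  gdeg0 : forall d, gdeg d 0;
  gdegB : forall d x y, gdeg d x -> gdeg d y -> gdeg d (x - y);
  gdegL : forall d e a x, rdeg e a -> gdeg d x -> gdeg (d + e) (a *: x);
  gdegR : forall d e a x, rdeg e a -> gdeg d x -> gdeg (d + e) (ract x a);
  gdeg_split : forall x, exists l : seq gcar,
    (forall y, y \in l -> exists d, gdeg d y) /\ x = \sum_(y <- l) y;
  gdeg_sum0 : forall (D : seq int) (c : int -> gcar), uniq D ->
    (forall d, gdeg d (c d)) -> \sum_(d <- D) c d = 0 ->
    forall d, d \in D -> c d = 0
}.

Section BimodTheory.
Variable M : gbimod.
Implicit Types x y : M.

Lemma ract0l a : ract (0 : M) a = 0.
Proof. by apply: (addrI (ract (0 : M) a)); rewrite -ractDl !addr0. Qed.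
Lemma ract0r x : ract x 0 = 0.
Proof. by apply: (addrI (ract x 0)); rewrite -ractDr !addr0. Qed.
Lemma ractNl x a : ract (- x) a = - ract x a.
Proof. by apply: (addrI (ract x a)); rewrite -ractDl !subrr ract0l. Qed.
Lemma ractBl x y a : ract (x - y) a = ract x a - ract y a.
Proof. by rewrite ractDl ractNl. Qed.
Lemma ract_suml (I : Type) (r : seq I) (F : I -> M) a :
  ract (\sum_(i <- r) F i) a = \sum_(i <- r) ract (F i) a.
Proof. by elim/big_rec2: _ => [|i y x _ <-]; rewrite ?ract0l ?ractDl. Qed.
Lemma ract_sumr (I : Type) (r : seq I) (F : I -> R) x :
  ract x (\sum_(i <- r) F i) = \sum_(i <- r) ract x (F i).
Proof. by elim/big_rec2: _ => [|i y z _ <-]; rewrite ?ract0r ?ractDr. Qed.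

Lemma gdegN d x : gdeg d x -> gdeg d (- x).
Proof. by move=> h; rewrite -sub0r; apply: gdegB => //; apply: gdeg0. Qed.
Lemma gdegD d x y : gdeg d x -> gdeg d y -> gdeg d (x + y).
Proof. by move=> hx hy; rewrite -[y]opprK; apply: gdegB => //; apply: gdegN. Qed.
Lemma gdeg_sum (I : eqType) (r : seq I) (F : I -> M) d :
  (forall i, i \in r -> gdeg d (F i)) -> gdeg d (\sum_(i <- r) F i).
Proof.
move=> h; rewrite big_seq; elim/big_ind: _ => //; first exact: gdeg0.
exact: gdegD.
Qed.

Lemma gdeg_dec x : exists Dc : seq int * (int -> M),
  [/\ uniq Dc.1, forall d, gdeg d (Dc.2 d), x = \sum_(d <- Dc.1) Dc.2 d &
      forall d, d \notin Dc.1 -> Dc.2 d = 0].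
Proof.
have [l [hl ->]] := gdeg_split x; elim: l hl => [|y l IH] hl.
  exists ([::], fun=> 0); split => //; first by move=> d; apply: gdeg0.
  by rewrite !big_nil.
have [|[D c] /= [uD hc e h0]] := IH.
  by move=> z hz; apply: hl; rewrite inE hz orbT.
have [d hd] := hl y (mem_head _ _).
pose c' f := if f == d then c f + y else c f.
have [E [uE dE sE]] : exists E, [/\ uniq E, d \in E & {subset D <= E}].
  exists (undup (d :: D)); split; first exact: undup_uniq.
    by rewrite mem_undup mem_head.
  by move=> f hf; rewrite mem_undup inE hf orbT.
exists (E, c'); split=> //=.
- by move=> f; rewrite /c'; case: eqP => [->|_] //; apply: gdegD.
- rewrite big_cons e.
  have -> : \sum_(f <- D) c f = \sum_(f <- E) c f.
    rewrite [RHS](bigID (mem D)) /= [X in _ + X]big1 ?addr0; last by move=> f /h0.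
    rewrite -[RHS]big_filter; apply: perm_big; apply: uniq_perm => //.
      exact: filter_uniq.
    by move=> f; rewrite mem_filter andb_idr // => /sE.
  rewrite (bigD1_seq d) // [RHS](bigD1_seq d) //=.
  rewrite /c' eqxx addrA [y + _]addrC; congr (_ + _).
  by apply: eq_bigr => f /negbTE nf; rewrite /c' nf.
- move=> f hf; rewrite /c'; case: eqP => [fd|_].
    by rewrite fd dE in hf.
  by apply: h0; apply: contra hf => /sE.
Qed.

Definition gsupp x : seq int := (projT1 (cid (gdeg_dec x))).1.
Definition gcomp d x : M := (projT1 (cid (gdeg_dec x))).2 d.

Lemma gsupp_uniq x : uniq (gsupp x).
Proof. by have [] := projT2 (cid (gdeg_dec x)). Qed.
Lemma gcomp_deg d x : gdeg d (gcomp d x).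
Proof. by have [] := projT2 (cid (gdeg_dec x)). Qed.
Lemma gcompE x : x = \sum_(d <- gsupp x) gcomp d x.
Proof. by have [] := projT2 (cid (gdeg_dec x)). Qed.
Lemma gcomp_supp x d : d \notin gsupp x -> gcomp d x = 0.
Proof. by have [_ _ _] := projT2 (cid (gdeg_dec x)); apply. Qed.

Lemma gsum_supp (D : seq int) (F : int -> M) : uniq D ->
  (forall d, d \notin D -> F d = 0) -> forall E, uniq E -> {subset D <= E} ->
  \sum_(d <- D) F d = \sum_(d <- E) F d.
Proof.
move=> uD h0 E uE sDE; rewrite [RHS](bigID (mem D)) /= [X in _ + X]big1 //.
rewrite addr0 -[RHS]big_filter; apply: perm_big; apply: uniq_perm => //.
  exact: filter_uniq.
by move=> d; rewrite mem_filter andb_idr // => /sDE.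
Qed.

Lemma gcomp_uniq x (D : seq int) (c : int -> M) : uniq D ->
  (forall d, gdeg d (c d)) -> x = \sum_(d <- D) c d ->
  forall d, gcomp d x = if d \in D then c d else 0.
Proof.
move=> uD hc e d.
pose c' f := if f \in D then c f else 0.
have hc' f : gdeg f (c' f) by rewrite /c'; case: ifP => _ //; apply: gdeg0.
pose E := undup (d :: gsupp x ++ D).
have sE : \sum_(f <- E) (gcomp f x - c' f) = 0.
  rewrite big_split sumrN /=.
  rewrite -(gsum_supp (gsupp_uniq x) (@gcomp_supp x)) ?undup_uniq //; last first.
    by move=> f hf; rewrite mem_undup inE mem_cat hf orbT.
  rewrite -(@gsum_supp D c') ?undup_uniq //; last first.
  - by move=> f hf; rewrite mem_undup inE mem_cat hf !orbT.
  - by move=> f /negbTE; rewrite /c' => ->.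
  rewrite -gcompE {1}e; apply/eqP; rewrite subr_eq0; apply/eqP.
  by apply: eq_big_seq => f hf; rewrite /c' hf.
apply/eqP; rewrite -subr_eq0; apply/eqP.
apply: (gdeg_sum0 (undup_uniq _) _ sE (d := d)).
  by move=> f; apply: gdegB => //; apply: gcomp_deg.
by rewrite mem_undup mem_head.
Qed.

Lemma gcomp_homog d e x : gdeg d x -> gcomp e x = if e == d then x else 0.
Proof.
move=> hx; rewrite (@gcomp_uniq x [:: d] (fun f => if f == d then x else 0)) //.
- by rewrite inE; case: eqP.
- by move=> f; case: eqP => [->|_] //; apply: gdeg0.
- by rewrite big_seq1 eqxx.
Qed.

Lemma gcompD e x y : gcomp e (x + y) = gcomp e x + gcomp e y.
Proof.
pose E := undup (e :: gsupp x ++ gsupp y).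
rewrite (@gcomp_uniq _ E (fun f => gcomp f x + gcomp f y)) ?undup_uniq //.
- by rewrite mem_undup mem_head.
- by move=> f; apply: gdegD; apply: gcomp_deg.
rewrite big_split /= -(gsum_supp (gsupp_uniq x) (@gcomp_supp x)) ?undup_uniq //.
  rewrite -(gsum_supp (gsupp_uniq y) (@gcomp_supp y)) ?undup_uniq //.
    by rewrite -!gcompE.
  by move=> f hf; rewrite mem_undup inE mem_cat hf !orbT.
by move=> f hf; rewrite mem_undup inE mem_cat hf orbT.
Qed.

End BimodTheory.

(* f is a bimodule map sending degree e to degree e + d for all e, i.e. a     *)
(* morphism of graded bimodules M -> N(d).                                    *)
Record bihom (M N : gbimod) (d : int) (f : M -> N) : Prop := BiHom {
  bihomD : forall x y, f (x + y) = f x + f y;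
  bihomL : forall a x, f (a *: x) = a *: f x;
  bihomR : forall a x, f (ract x a) = ract (f x) a;
  bihom_deg : forall e x, gdeg e x -> gdeg (e + d) (f x)
}.

Record ghom (M N : gbimod) := GHom {
  ghom_fun :> M -> N;
  ghomP : bihom 0 ghom_fun
}.

Lemma bihom_id (M : gbimod) : bihom 0 (idfun : M -> M).
Proof. by split=> // e x; rewrite addr0. Qed.

Lemma bihom_comp (M N P : gbimod) d e (g : N -> P) (f : M -> N) :
  bihom e g -> bihom d f -> bihom (d + e) (g \o f).
Proof.
move=> hg hf; split=> /= *.
- by rewrite (bihomD hf) (bihomD hg).
- by rewrite (bihomL hf) (bihomL hg).
- by rewrite (bihomR hf) (bihomR hg).
- by rewrite addrA; apply: (bihom_deg hg); apply: (bihom_deg hf).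
Qed.

Definition gid (M : gbimod) : ghom M M := GHom (bihom_id M).
Definition gcomp_hom (M N P : gbimod) (g : ghom N P) (f : ghom M N) :
  ghom M P := GHom (bihom_comp (ghomP g) (ghomP f)).

Lemma bihom0 (M N : gbimod) d (f : M -> N) : bihom d f -> f 0 = 0.
Proof. by move=> h; apply: (addrI (f 0)); rewrite -(bihomD h) !addr0. Qed.

Lemma bihomN (M N : gbimod) d (f : M -> N) x : bihom d f -> f (- x) = - f x.
Proof.
move=> h; apply: (addrI (f x)); rewrite -(bihomD h) !subrr; exact: bihom0 h.
Qed.

Lemma bihom_sum (M N : gbimod) d (f : M -> N) (I : Type) (r : seq I) F :
  bihom d f -> f (\sum_(i <- r) F i) = \sum_(i <- r) f (F i).
Proof.
move=> h; elim/big_rec2: _ => [|i y x _ <-]; first exact: bihom0 h.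
by rewrite (bihomD h).
Qed.

(* M(j), with M(j)_d = M_{d+j}. *)
Program Definition shift (M : gbimod) (j : int) : gbimod :=
  @GBimod M (@ract M) (fun d => gdeg (d + j))
    (@ractDl M) (@ractDr M) (@ract1 M) (@ractM M) (@lractA M) (@ractC M)
    (fun d => gdeg0 M (d + j)) _ _ _ _ _.
Next Obligation. exact: gdegB. Qed.
Next Obligation. by rewrite addrAC; apply: gdegL. Qed.
Next Obligation. by rewrite addrAC; apply: gdegR. Qed.
Next Obligation.
have [l [hl e]] := gdeg_split x; exists l; split=> // y /hl[d hd].
by exists (d - j); rewrite subrK.
Qed.
Next Obligation.
have addj : injective (fun f : int => f + j) by apply: addIr.
rewrite -[d](addrK j).
apply: (@gdeg_sum0 M [seq f + j | f <- D] (fun f => c (f - j)) _ _ _ (d + j)).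
- by rewrite map_inj_uniq.
- by move=> f; rewrite -[f in gdeg f](subrK j).
- by rewrite big_map -[RHS]H1; apply: eq_bigr => f _; rewrite addrK.
- by rewrite (mem_map addj).
Qed.

Program Definition Rbim : gbimod :=
  @GBimod R^o (fun x a => x * a) (fun d (a : R) => rdeg d a)
    _ _ _ _ _ _ _ _ _ _ _ _.
Next Obligation. exact: mulrDl. Qed.
Next Obligation. exact: mulrDr. Qed.
Next Obligation. exact: mulr1. Qed.
Next Obligation. exact: mulrA. Qed.
Next Obligation. exact: mulrA. Qed.
Next Obligation. exact: mulrC. Qed.
Next Obligation. exact: rdeg0. Qed.
Next Obligation. exact: rdegB. Qed.
Next Obligation. by rewrite addrC; apply: rdegM. Qed.
Next Obligation. exact: rdegM. Qed.
Next Obligation. exact: rdeg_split. Qed.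
Next Obligation. exact: rdeg_sum0 H1 _ _. Qed.

Program Definition dsum (M N : gbimod) : gbimod :=
  @GBimod (M * N)%type (fun x a => (ract x.1 a, ract x.2 a))
    (fun d x => gdeg d x.1 /\ gdeg d x.2) _ _ _ _ _ _ _ _ _ _ _ _.
Next Obligation. by rewrite !ractDl. Qed.
Next Obligation. by rewrite !ractDr. Qed.
Next Obligation. by case: x => x y; rewrite /= !ract1. Qed.
Next Obligation. by rewrite !ractM. Qed.
Next Obligation. by congr pair; apply: lractA. Qed.
Next Obligation. by rewrite !ractC. Qed.
Next Obligation. by split; apply: gdeg0. Qed.
Next Obligation. by move: H H0 => /= [? ?] [? ?]; split; apply: gdegB. Qed.
Next Obligation. by move: H0 => /= [? ?]; split; apply: gdegL. Qed.
Next Obligation. by move: H0 => /= [? ?]; split; apply: gdegR. Qed.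
Next Obligation.
case: x => x y; have [l [hl ->]] := gdeg_split x.
have [l' [hl' ->]] := gdeg_split y.
exists ([seq (z, 0) | z <- l] ++ [seq (0, z) | z <- l']); split.
  move=> z; rewrite mem_cat => /orP[] /mapP[z' hz ->] /=.
    by have [d hd] := hl _ hz; exists d; split=> //; apply: gdeg0.
  by have [d hd] := hl' _ hz; exists d; split=> //; apply: gdeg0.
rewrite big_cat /= !big_map.
have -> : \sum_(j <- l) (j, 0 : N) = (\sum_(j <- l) j, 0).
  elim: l {hl} => [|z l IH]; first by rewrite !big_nil.
  by rewrite !big_cons IH; congr pair; rewrite /= addr0.
have -> : \sum_(j <- l') (0 : M, j) = (0, \sum_(j <- l') j).
  elim: l' {hl'} => [|z l' IH]; first by rewrite !big_nil.
  by rewrite !big_cons IH; congr pair; rewrite /= addr0.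
by congr pair; rewrite /= ?addr0 ?add0r.
Qed.
Next Obligation.
have e1 : (\sum_(d <- D) c d).1 = \sum_(d <- D) (c d).1.
  exact: (big_morph fst).
have e2 : (\sum_(d <- D) c d).2 = \sum_(d <- D) (c d).2.
  exact: (big_morph snd).
rewrite H1 /= in e1 e2; apply: injective_projections => /=.
  by apply: (gdeg_sum0 H (fun f => proj1 (H0 f)) (esym e1)).
by apply: (gdeg_sum0 H (fun f => proj2 (H0 f)) (esym e2)).
Qed.

(* Sets of scalars containing the homogeneous components of their elements.   *)
Record hset := HSet {
  hset_mem :> R -> Prop;
  hset_split : forall a, hset_mem a -> exists l : seq R,
    (forall b, b \in l -> hset_mem b /\ exists d, rdeg d b) /\
    a = \sum_(b <- l) b
}.

Program Definition hsetT : hset := @HSet (fun _ => True) _.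
Next Obligation.
by have [l [hl e]] := rdeg_split a; exists l; split=> // b /hl.
Qed.

(* The tensor product of M and N over a subring S of R, by generators and     *)
(* relations: a list of pairs stands for the sum of the corresponding pure    *)
(* tensors.                                                                   *)
Section Tensor.
Variables (S : hset) (M N : gbimod).

Inductive tens_eq : seq (M * N) -> seq (M * N) -> Prop :=
| teq_refl l : tens_eq l l
| teq_sym l1 l2 : tens_eq l1 l2 -> tens_eq l2 l1
| teq_trans l1 l2 l3 : tens_eq l1 l2 -> tens_eq l2 l3 -> tens_eq l1 l3
| teq_cat l1 l1' l2 l2' :
    tens_eq l1 l1' -> tens_eq l2 l2' -> tens_eq (l1 ++ l2) (l1' ++ l2')
| teq_catC l1 l2 : tens_eq (l1 ++ l2) (l2 ++ l1)
| teq_0 y : tens_eq [:: (0, y)] [::]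
| teq_Dl x x' y : tens_eq [:: (x + x', y)] [:: (x, y); (x', y)]
| teq_Dr x y y' : tens_eq [:: (x, y + y')] [:: (x, y); (x, y')]
| teq_bal x a y : S a -> tens_eq [:: (ract x a, y)] [:: (x, a *: y)].

Definition tens_eqb (l1 l2 : seq (M * N)) : bool := `[< tens_eq l1 l2 >].

Lemma tens_eqb_refl : reflexive tens_eqb.
Proof. by move=> l; apply/asboolP; apply: teq_refl. Qed.
Lemma tens_eqb_sym : ssrbool.symmetric tens_eqb.
Proof. by move=> l1 l2; apply/asboolP/asboolP; apply: teq_sym. Qed.
Lemma tens_eqb_trans : transitive tens_eqb.
Proof.
by move=> l2 l1 l3 /asboolP h /asboolP h'; apply/asboolP; apply: teq_trans h'.
Qed.
Canonical tens_equiv :=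
  EquivRel tens_eqb tens_eqb_refl tens_eqb_sym tens_eqb_trans.

Definition tens := {eq_quot tens_equiv}.
HB.instance Definition _ := Choice.on tens.

Definition tpi (l : seq (M * N)) : tens := \pi_tens l.

Lemma tpiP l1 l2 : tens_eq l1 l2 <-> tpi l1 = tpi l2.
Proof.
split=> [h|/eqmodP /asboolP //]; apply/eqmodP; exact/asboolP.
Qed.
Lemma tpi_repr (t : tens) : tpi (repr t) = t.
Proof. exact: reprK. Qed.
Lemma tpi_ind (P : tens -> Prop) : (forall l, P (tpi l)) -> forall t, P t.
Proof. by move=> h t; rewrite -(tpi_repr t). Qed.

Definition tadd (t u : tens) : tens := tpi (repr t ++ repr u).
Definition topp (t : tens) : tens := tpi [seq (- p.1, p.2) | p <- repr t].

Lemma taddE l1 l2 : tadd (tpi l1) (tpi l2) = tpi (l1 ++ l2).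
Proof. by apply/tpiP/teq_cat; apply/tpiP; rewrite tpi_repr. Qed.
Lemma taddA : associative tadd.
Proof.
by elim/tpi_ind=> x; elim/tpi_ind=> y; elim/tpi_ind=> z; rewrite !taddE catA.
Qed.
Lemma taddC : commutative tadd.
Proof.
by elim/tpi_ind=> x; elim/tpi_ind=> y; rewrite !taddE; apply/tpiP/teq_catC.
Qed.
Lemma tadd0 : left_id (tpi [::]) tadd.
Proof. by elim/tpi_ind=> x; rewrite taddE. Qed.
Lemma taddN : left_inverse (tpi [::]) topp tadd.
Proof.
move=> t; rewrite -{2}(tpi_repr t) /topp taddE.
elim: (repr t) => [|[x y] l IH] //=.
set l' := map _ l in IH *; rewrite -!taddE in IH.
have -> : tpi ((- x, y) :: l' ++ (x, y) :: l) =
          tadd (tpi [:: (- x, y)]) (tadd (tpi l') (tadd (tpi [:: (x, y)]) (tpi l))).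
  by rewrite !taddE.
rewrite [tadd (tpi [:: (x, y)]) _]taddC 2!taddA taddC taddA.
have -> : tadd (tadd (tpi [:: (x, y)]) (tadd (tpi [:: (- x, y)]) (tpi l')))
               (tpi l) =
          tadd (tadd (tpi [:: (x, y)]) (tpi [:: (- x, y)]))
               (tadd (tpi l') (tpi l)) by rewrite !taddA.
rewrite IH taddE taddC tadd0 /=; apply/tpiP.
apply: teq_trans (teq_sym (teq_Dl _ _ _)) _; rewrite subrr; exact: teq_0.
Qed.

HB.instance Definition _ :=
  GRing.isZmodule.Build tens taddA taddC tadd0 taddN.

Definition tau (x : M) (y : N) : tens := tpi [:: (x, y)].

Lemma tpi_cat l1 l2 : tpi (l1 ++ l2) = tpi l1 + tpi l2.
Proof. by rewrite -taddE. Qed.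
Lemma tpiE l : tpi l = \sum_(p <- l) tau p.1 p.2.
Proof.
elim: l => [|[x y] l IH]; first by rewrite big_nil.
by rewrite big_cons -IH -cat1s tpi_cat.
Qed.
Lemma tensE (t : tens) : t = \sum_(p <- repr t) tau p.1 p.2.
Proof. by rewrite -tpiE tpi_repr. Qed.
Lemma tauDl x x' y : tau (x + x') y = tau x y + tau x' y.
Proof. by rewrite -tpi_cat; apply/tpiP/teq_Dl. Qed.
Lemma tauDr x y y' : tau x (y + y') = tau x y + tau x y'.
Proof. by rewrite -tpi_cat; apply/tpiP/teq_Dr. Qed.
Lemma tau_bal x a y : S a -> tau (ract x a) y = tau x (a *: y).
Proof. by move=> h; apply/tpiP/teq_bal. Qed.
Lemma tau0l y : tau 0 y = 0.
Proof. by apply: (addrI (tau 0 y)); rewrite -tauDl !addr0. Qed.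
Lemma tau0r x : tau x 0 = 0.
Proof. by apply: (addrI (tau x 0)); rewrite -tauDr !addr0. Qed.

Lemma tau_suml (I : Type) (r : seq I) F y :
  tau (\sum_(i <- r) F i) y = \sum_(i <- r) tau (F i) y.
Proof. by elim/big_rec2: _ => [|i u x _ <-]; rewrite ?tau0l ?tauDl. Qed.
Lemma tau_sumr (I : Type) (r : seq I) F x :
  tau x (\sum_(i <- r) F i) = \sum_(i <- r) tau x (F i).
Proof. by elim/big_rec2: _ => [|i u y _ <-]; rewrite ?tau0r ?tauDr. Qed.

Record balanced (X : zmodType) (phi : M -> N -> X) : Prop := Balanced {
  balDl : forall x x' y, phi (x + x') y = phi x y + phi x' y;
  balDr : forall x y y', phi x (y + y') = phi x y + phi x y';
  bal_bal : forall x a y, S a -> phi (ract x a) y = phi x (a *: y)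
}.

Definition tlift (X : zmodType) (phi : M -> N -> X) (t : tens) : X :=
  \sum_(p <- repr t) phi p.1 p.2.

Lemma tlift_pi (X : zmodType) (phi : M -> N -> X) l : balanced phi ->
  tlift phi (tpi l) = \sum_(p <- l) phi p.1 p.2.
Proof.
move=> h; rewrite /tlift.
have: tens_eq (repr (tpi l)) l by apply/tpiP; rewrite tpi_repr.
move: (repr _) => l0; elim=> {l l0} //=.
- by move=> l1 l2 l3 _ -> _ ->.
- by move=> l1 l1' l2 l2' _ e1 _ e2; rewrite !big_cat /= e1 e2.
- by move=> l1 l2; rewrite !big_cat /= addrC.
- move=> y; rewrite big_seq1 big_nil /=.
  by apply: (addrI (phi 0 y)); rewrite -(balDl h) !addr0.
- by move=> x x' y; rewrite !big_cons !big_nil /= !addr0 (balDl h).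
- by move=> x x' y; rewrite !big_cons !big_nil /= !addr0 (balDr h).
- by move=> x a y ha; rewrite !big_seq1 /= (bal_bal h).
Qed.

Lemma tlift_tau (X : zmodType) (phi : M -> N -> X) x y : balanced phi ->
  tlift phi (tau x y) = phi x y.
Proof. by move=> h; rewrite /tau tlift_pi // big_seq1. Qed.

Lemma tliftD (X : zmodType) (phi : M -> N -> X) t u : balanced phi ->
  tlift phi (t + u) = tlift phi t + tlift phi u.
Proof.
move=> h; elim/tpi_ind: t => l; elim/tpi_ind: u => l'.
by rewrite -tpi_cat !tlift_pi // big_cat.
Qed.

Lemma tens_ext (X : zmodType) (f g : tens -> X) :
  (forall t u, f (t + u) = f t + f u) -> (forall t u, g (t + u) = g t + g u) ->
  (forall x y, f (tau x y) = g (tau x y)) -> f =1 g.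
Proof.
move=> hf hg e t; rewrite (tensE t).
have f0 : f 0 = 0 by apply: (addrI (f 0)); rewrite -hf !addr0.
have g0 : g 0 = 0 by apply: (addrI (g 0)); rewrite -hg !addr0.
elim: (repr t) => [|p l IH]; first by rewrite big_nil f0 g0.
by rewrite big_cons hf hg e IH.
Qed.

Lemma balL a : balanced (fun x y => tau (a *: x) y).
Proof.
split=> *; first by rewrite scalerDr tauDl.
  exact: tauDr.
by rewrite lractA tau_bal.
Qed.
Lemma balR a : balanced (fun x y => tau x (ract y a)).
Proof.
split=> *; first exact: tauDl.
  by rewrite ractDl tauDr.
by rewrite tau_bal // lractA.
Qed.

Definition tscale a : tens -> tens := tlift (fun x y => tau (a *: x) y).
Definition tract (t : tens) a : tens := tlift (fun x y => tau x (ract y a)) t.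

Lemma tscale_tau a x y : tscale a (tau x y) = tau (a *: x) y.
Proof. by rewrite /tscale tlift_tau //; apply: balL. Qed.
Lemma tract_tau a x y : tract (tau x y) a = tau x (ract y a).
Proof. by rewrite /tract tlift_tau //; apply: balR. Qed.
Lemma tscaleDr a t u : tscale a (t + u) = tscale a t + tscale a u.
Proof. exact: tliftD (balL a). Qed.
Lemma tractDl t u a : tract (t + u) a = tract t a + tract u a.
Proof. exact: tliftD (balR a). Qed.

Lemma tscaleA a b t : tscale a (tscale b t) = tscale (a * b) t.
Proof.
apply: (@tens_ext _ (fun t => tscale a (tscale b t)) (tscale (a * b))) => *;
  by rewrite ?tscaleDr // !tscale_tau scalerA.
Qed.
Lemma tscale1 : left_id 1 tscale.
Proof.
apply: (@tens_ext _ (tscale 1) id) => *; rewrite ?tscaleDr //.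
by rewrite tscale_tau scale1r.
Qed.
Lemma tscaleDl t : {morph tscale^~ t : a b / a + b}.
Proof.
move=> a b.
apply: (@tens_ext _ (tscale (a + b)) (fun t => tscale a t + tscale b t)) => *;
  rewrite ?tscaleDr // 1?addrACA //.
by rewrite !tscale_tau scalerDl tauDl.
Qed.

HB.instance Definition _ := GRing.Zmodule_isLmodule.Build R tens
  tscaleA tscale1 tscaleDr tscaleDl.

Lemma tractDr t a b : tract t (a + b) = tract t a + tract t b.
Proof.
apply: (@tens_ext _ (tract^~ (a + b)) (fun t => tract t a + tract t b)) => *;
  rewrite ?tractDl // 1?addrACA //.
by rewrite !tract_tau ractDr tauDr.
Qed.
Lemma tract1 t : tract t 1 = t.
Proof.
apply: (@tens_ext _ (tract^~ 1) id) => *; rewrite ?tractDl //.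
by rewrite tract_tau ract1.
Qed.
Lemma tractM t a b : tract t (a * b) = tract (tract t a) b.
Proof.
apply: (@tens_ext _ (tract^~ (a * b)) (fun t => tract (tract t a) b)) => *;
  by rewrite ?tractDl // !tract_tau ractM.
Qed.
Lemma tlractA a t b : tscale a (tract t b) = tract (tscale a t) b.
Proof.
apply: (@tens_ext _ (fun t => tscale a (tract t b))
                    (fun t => tract (tscale a t) b)) => *;
  by rewrite ?tractDl ?tscaleDr ?tractDl // tscale_tau !tract_tau tscale_tau.
Qed.

Lemma tractC (hS : forall c : k, S c%:MP) t (c : k) :
  tract t c%:MP = tscale c%:MP t.
Proof.
apply: (@tens_ext _ (tract^~ c%:MP) (tscale c%:MP)) => *;
  rewrite ?tractDl ?tscaleDr //.
by rewrite tract_tau tscale_tau ractC -tau_bal // ractC.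
Qed.

Definition tdeg d (t : tens) : Prop := exists l : seq (M * N),
  (forall p, p \in l -> exists i j, [/\ i + j = d, gdeg i p.1 & gdeg j p.2]) /\
  t = \sum_(p <- l) tau p.1 p.2.

Lemma tdeg0 d : tdeg d 0.
Proof. by exists [::]; rewrite big_nil. Qed.
Lemma tdegD d t u : tdeg d t -> tdeg d u -> tdeg d (t + u).
Proof.
move=> [l [hl ->]] [l' [hl' ->]]; exists (l ++ l'); split; last by rewrite big_cat.
by move=> p; rewrite mem_cat => /orP[/hl|/hl'].
Qed.
Lemma tdeg_tau i j x y : gdeg i x -> gdeg j y -> tdeg (i + j) (tau x y).
Proof.
move=> hx hy; exists [:: (x, y)]; split; last by rewrite big_seq1.
by move=> p; rewrite inE => /eqP -> /=; exists i, j.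
Qed.
Lemma tdeg_ind d (P : tens -> Prop) : P 0 ->
  (forall t u, P t -> P u -> P (t + u)) ->
  (forall i j x y, i + j = d -> gdeg i x -> gdeg j y -> P (tau x y)) ->
  forall t, tdeg d t -> P t.
Proof.
move=> P0 PD Pt t [l [hl ->]]; rewrite big_seq; elim/big_ind: _ => //.
by move=> [x y] /hl[i [j [e hx hy]]]; apply: Pt e hx hy.
Qed.
Lemma tauNl x y : tau (- x) y = - tau x y.
Proof. by apply: (addrI (tau x y)); rewrite -tauDl !subrr tau0l. Qed.
Lemma tdegB d t u : tdeg d t -> tdeg d u -> tdeg d (t - u).
Proof.
move=> ht hu; apply: tdegD => //; elim/tdeg_ind: u / hu.
- by rewrite oppr0; apply: tdeg0.
- by move=> u u' hu hu'; rewrite opprD; apply: tdegD.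
- move=> i j x y <- hx hy; rewrite -tauNl; apply: tdeg_tau => //.
  exact: gdegN.
Qed.
Lemma tdegL d e a t : rdeg e a -> tdeg d t -> tdeg (d + e) (tscale a t).
Proof.
move=> ha; elim/tdeg_ind=> [|u u' hu hu'|i j x y <- hx hy].
- have -> : tscale a 0 = 0 by apply: (addrI (tscale a 0)); rewrite -tscaleDr !addr0.
  exact: tdeg0.
- by rewrite tscaleDr; apply: tdegD.
- by rewrite tscale_tau addrAC; apply: tdeg_tau => //; apply: gdegL.
Qed.
Lemma tdegR d e a t : rdeg e a -> tdeg d t -> tdeg (d + e) (tract t a).
Proof.
move=> ha; elim/tdeg_ind=> [|u u' hu hu'|i j x y <- hx hy].
- have -> : tract 0 a = 0 by apply: (addrI (tract 0 a)); rewrite -tractDl !addr0.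
  exact: tdeg0.
- by rewrite tractDl; apply: tdegD.
- by rewrite tract_tau -addrA; apply: tdeg_tau => //; apply: gdegR.
Qed.
Lemma tdeg_split t : exists l : seq tens,
  (forall u, u \in l -> exists d, tdeg d u) /\ t = \sum_(u <- l) u.
Proof.
rewrite (tensE t); elim: (repr t) => [|[x y] l [l' [hl' IH]]].
  by exists [::]; rewrite !big_nil.
exists ([seq tau (gcomp i x) (gcomp j y) | i <- gsupp x, j <- gsupp y] ++ l').
split=> [u|].
  rewrite mem_cat => /orP[/allpairsP[[i j] /= [_ _ ->]]|/hl' //].
  by exists (i + j); apply: tdeg_tau; apply: gcomp_deg.
rewrite big_cons big_cat /= -IH big_allpairs_dep; congr (_ + _).
rewrite {1}(gcompE x) tau_suml; apply: eq_bigr => i _.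
by rewrite {1}(gcompE y) tau_sumr.
Qed.

Definition tproj_fun e (x : M) (y : N) : tens :=
  \sum_(i <- gsupp x) tau (gcomp i x) (gcomp (e - i) y).

Lemma tproj_funE e x y (E : seq int) : uniq E -> {subset gsupp x <= E} ->
  tproj_fun e x y = \sum_(i <- E) tau (gcomp i x) (gcomp (e - i) y).
Proof.
move=> uE sE; rewrite [RHS](bigID (mem (gsupp x))) /= [X in _ + X]big1.
  rewrite addr0 -[RHS]big_filter; apply: perm_big; apply: uniq_perm.
  - exact: gsupp_uniq.
  - exact: filter_uniq.
  - by move=> d; rewrite mem_filter andb_idr // => /sE.
by move=> i /gcomp_supp ->; rewrite tau0l.
Qed.

Lemma tproj_funDl e x x' y :
  tproj_fun e (x + x') y = tproj_fun e x y + tproj_fun e x' y.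
Proof.
pose E := undup (gsupp (x + x') ++ gsupp x ++ gsupp x').
rewrite !(@tproj_funE _ _ _ E) ?undup_uniq //.
- by rewrite -big_split; apply: eq_bigr => i _; rewrite gcompD tauDl.
- by move=> d hd; rewrite mem_undup !mem_cat hd !orbT.
- by move=> d hd; rewrite mem_undup !mem_cat hd !orbT.
- by move=> d hd; rewrite mem_undup !mem_cat hd.
Qed.
Lemma tproj_funDr e x y y' :
  tproj_fun e x (y + y') = tproj_fun e x y + tproj_fun e x y'.
Proof. by rewrite -big_split; apply: eq_bigr => i _; rewrite gcompD tauDr. Qed.
Lemma tproj_fun_homog e i j x y : gdeg i x -> gdeg j y ->
  tproj_fun e x y = if i + j == e then tau x y else 0.
Proof.
move=> hx hy; rewrite (@tproj_funE _ _ _ (undup (i :: gsupp x))) ?undup_uniq //.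
  rewrite (bigD1_seq i) ?undup_uniq ?mem_undup ?mem_head //= big1 ?addr0.
    rewrite (gcomp_homog _ hx) eqxx (gcomp_homog _ hy) subr_eq [j + i]addrC.
    by rewrite eq_sym; case: eqP => //; rewrite tau0r.
  by move=> f /negbTE nf; rewrite (gcomp_homog _ hx) nf tau0l.
by move=> d hd; rewrite mem_undup inE hd orbT.
Qed.

Lemma tproj_bal e : balanced (tproj_fun e).
Proof.
split; first exact: tproj_funDl.
  exact: tproj_funDr.
move=> x a y ha; have [l [hl ->]] := hset_split ha.
have F0l z : tproj_fun e 0 z = 0.
  by apply: (addrI (tproj_fun e 0 z)); rewrite -tproj_funDl !addr0.
have F0r z : tproj_fun e z 0 = 0.
  by apply: (addrI (tproj_fun e z 0)); rewrite -tproj_funDr !addr0.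
have Fl (I : Type) (r : seq I) F z :
    tproj_fun e (\sum_(i <- r) F i) z = \sum_(i <- r) tproj_fun e (F i) z.
  by elim/big_rec2: _ => [|i u w _ <-]; rewrite ?F0l ?tproj_funDl.
have Fr (I : Type) (r : seq I) F z :
    tproj_fun e z (\sum_(i <- r) F i) = \sum_(i <- r) tproj_fun e z (F i).
  by elim/big_rec2: _ => [|i u w _ <-]; rewrite ?F0r ?tproj_funDr.
rewrite ract_sumr scaler_suml Fl Fr; apply: eq_big_seq => b /hl[hb [d hd]].
rewrite (gcompE x) (gcompE y) ract_suml !Fl; apply: eq_bigr => i _.
rewrite scaler_sumr !Fr; apply: eq_bigr => j _.
have hi := gcomp_deg i x; have hj := gcomp_deg j y.
rewrite (tproj_fun_homog _ (gdegR hd hi) hj) (tproj_fun_homog _ hi (gdegL hd hj)).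
by rewrite tau_bal // -addrA [d + j]addrC.
Qed.

Lemma tproj_tdeg e d t : tdeg d t ->
  tlift (tproj_fun e) t = if d == e then t else 0.
Proof.
have b := tproj_bal e; elim/tdeg_ind=> [|u u' hu hu'|i j x y <- hx hy].
- have -> : tlift (tproj_fun e) 0 = 0.
    by apply: (addrI (tlift (tproj_fun e) 0)); rewrite -tliftD // !addr0.
  by case: ifP.
- by rewrite tliftD // hu hu'; case: ifP => //; rewrite addr0.
- by rewrite tlift_tau //; apply: tproj_fun_homog.
Qed.

Lemma tdeg_sum0 (D : seq int) (c : int -> tens) : uniq D ->
  (forall d, tdeg d (c d)) -> \sum_(d <- D) c d = 0 ->
  forall d, d \in D -> c d = 0.
Proof.
move=> uD hc h d dD; have b := tproj_bal d.
have L0 : tlift (tproj_fun d) 0 = 0.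
  by apply: (addrI (tlift (tproj_fun d) 0)); rewrite -tliftD // !addr0.
have := congr1 (tlift (tproj_fun d)) h; rewrite L0.
rewrite (big_morph _ (fun t u => tliftD t u b) L0) (bigD1_seq d) //= big1.
  by rewrite addr0 (tproj_tdeg _ (hc d)) eqxx.
by move=> e /negbTE ne; rewrite (tproj_tdeg _ (hc e)) ne.
Qed.

Definition tensor (hS : forall c : k, S c%:MP) : gbimod :=
  @GBimod tens tract tdeg tractDl tractDr tract1 tractM tlractA (tractC hS)
    tdeg0 tdegB tdegL tdegR tdeg_split tdeg_sum0.

End Tensor.

Definition tensorR (M N : gbimod) : gbimod :=
  @tensor hsetT M N (fun=> I).

(* The kernel of the action of rho (x) 1 - 1 (x) rho. *)
Section Kernel.
Variables (rho : R) (e : int) (hrho : rdeg e rho) (M : gbimod).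

Definition ker_pred : {pred M} := [pred x : M | rho *: x == ract x rho].

Lemma ker_submod_closed : submod_closed ker_pred.
Proof.
split; first by rewrite inE scaler0 ract0l.
move=> a x y; rewrite !inE => /eqP hx /eqP hy.
by rewrite scalerDr scalerA mulrC -scalerA hx hy ractDl lractA.
Qed.

HB.instance Definition _ :=
  GRing.isSubmodClosed.Build R M ker_pred ker_submod_closed.

Record ker := Ker { ker_val :> M; ker_valP : ker_val \in ker_pred }.
HB.instance Definition _ := [isSub for ker_val].
HB.instance Definition _ := [Choice of ker by <:].
HB.instance Definition _ := [SubChoice_isSubLmodule of ker by <:].

Lemma kerE (x : ker) : rho *: (x : M) = ract (x : M) rho.
Proof. exact/eqP/(ker_valP x). Qed.

Lemma ker_ract_subproof (x : ker) a : ract (x : M) a \in ker_pred.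
Proof. by rewrite inE lractA kerE -!ractM mulrC. Qed.
Definition ker_ract (x : ker) a : ker := Ker (ker_ract_subproof x a).

Program Definition kerbim : gbimod :=
  @GBimod ker ker_ract (fun d x => gdeg d (x : M)) _ _ _ _ _ _ _ _ _ _ _ _.
Next Obligation. by apply: val_inj; apply: ractDl. Qed.
Next Obligation. by apply: val_inj; apply: ractDr. Qed.
Next Obligation. by apply: val_inj; apply: ract1. Qed.
Next Obligation. by apply: val_inj; apply: ractM. Qed.
Next Obligation. by apply: val_inj; apply: lractA. Qed.
Next Obligation. by apply: val_inj; apply: ractC. Qed.
Next Obligation. exact: gdeg0. Qed.
Next Obligation. exact: gdegB. Qed.
Next Obligation. exact: gdegL. Qed.
Next Obligation. exact: gdegR. Qed.
Next Obligation.
have hc d : gcomp d (x : M) \in ker_pred.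
  have [hd|hd] := boolP (d \in gsupp (x : M)); last first.
    by rewrite gcomp_supp // inE scaler0 ract0l.
  rewrite inE -subr_eq0; apply/eqP.
  have adde : injective (fun f : int => f + e) by apply: addIr.
  pose c f := rho *: gcomp (f - e) (x : M) - ract (gcomp (f - e) (x : M)) rho.
  rewrite -[d](addrK e).
  apply: (@gdeg_sum0 M [seq f + e | f <- gsupp (x : M)] c _ _ _ (d + e)).
  - by rewrite map_inj_uniq // gsupp_uniq.
  - move=> f; rewrite -{1}[f](subrK e).
    by apply: gdegB; [apply: gdegL|apply: gdegR] => //; apply: gcomp_deg.
  - rewrite big_map -[RHS](subrr (rho *: (x : M))) {2}kerE.
    rewrite (eq_bigr (fun f => rho *: gcomp f (x : M) - ract (gcomp f (x : M)) rho)).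
      by rewrite big_split sumrN /= -scaler_sumr -ract_suml -gcompE.
    by move=> f _; rewrite /c addrK.
  - by rewrite (mem_map adde).
exists [seq Ker (hc d) | d <- gsupp (x : M)]; split.
  by move=> y /mapP[d _ ->]; exists d; apply: gcomp_deg.
apply: val_inj; rewrite raddf_sum big_map /=; exact: gcompE.
Qed.
Next Obligation.
apply: val_inj.
apply: (@gdeg_sum0 M D (fun f => ker_val (c f)) H H0 _ d H2).
by rewrite -[RHS](congr1 val H1) raddf_sum.
Qed.

End Kernel.

Lemma ker_map_subproof rho (M N : gbimod) (f : ghom M N) (x : ker rho M) :
  f x \in @ker_pred rho N.
Proof.
by rewrite inE -(bihomL (ghomP f)) -(bihomR (ghomP f)) kerE.
Qed.
Program Definition ker_map rho e (hrho : rdeg e rho) (M N : gbimod)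
    (f : ghom M N) : ghom (kerbim hrho M) (kerbim hrho N) :=
  @GHom (kerbim hrho M) (kerbim hrho N)
    (fun x => Ker (ker_map_subproof f x)) _.
Next Obligation.
split=> *.
- by apply: val_inj; apply: (bihomD (ghomP f)).
- by apply: val_inj; apply: (bihomL (ghomP f)).
- by apply: val_inj; apply: (bihomR (ghomP f)).
- exact: (bihom_deg (ghomP f)).
Qed.

(* Hom(M, N): finite sums of homogeneous bimodule maps of arbitrary degrees,  *)
(* with (r f r')(b) = r f(b) r'.                                              *)
Section Hom.
Variables M N : gbimod.

Definition hom_pred : {pred (M -> N)} := fun f => `[< exists l : seq (M -> N),
  (forall g, g \in l -> exists d, @bihom M N d g) /\ f = \sum_(g <- l) g >].

Lemma fct_sumE (I : Type) (r : seq I) (F : I -> (M -> N)) x :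
  (\sum_(i <- r) F i) x = \sum_(i <- r) F i x.
Proof. by elim/big_rec2: _ => [|i y f _ <-]. Qed.

Lemma bihom_zero d : @bihom M N d 0.
Proof.
by split=> *; rewrite /= ?addr0 ?scaler0 ?ract0l //; apply: gdeg0.
Qed.
Lemma bihom_add d (f g : M -> N) : bihom d f -> bihom d g -> bihom d (f + g).
Proof.
move=> hf hg; split=> [x y|a x|a x|e x hx]; rewrite addrfctE /=.
- by rewrite (bihomD hf) (bihomD hg) addrACA.
- by rewrite (bihomL hf) (bihomL hg) scalerDr.
- by rewrite (bihomR hf) (bihomR hg) ractDl.
- by apply: gdegD; [apply: bihom_deg hf _ _ _|apply: bihom_deg hg _ _ _].
Qed.
Lemma bihom_opp d (f : M -> N) : bihom d f -> bihom d (- f).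
Proof.
move=> hf; split=> [x y|a x|a x|e x hx]; rewrite opprfctE /=.
- by rewrite (bihomD hf) opprD.
- by rewrite (bihomL hf) scalerN.
- by rewrite (bihomR hf) ractNl.
- by apply: gdegN; apply: bihom_deg hf _ _ _.
Qed.
Lemma bihom_scale d e a (f : M -> N) :
  rdeg e a -> bihom d f -> bihom (d + e) (a *: f).
Proof.
move=> ha hf; split=> [x y|b x|b x|i x hx]; rewrite scalrfctE /=.
- by rewrite (bihomD hf) scalerDr.
- by rewrite (bihomL hf) !scalerA mulrC.
- by rewrite (bihomR hf) lractA.
- by rewrite addrA; apply: gdegL => //; apply: bihom_deg hf _ _ _.
Qed.
Definition fun_ract (f : M -> N) a : M -> N := fun x => ract (f x) a.
Lemma bihom_ract d e a (f : M -> N) :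
  rdeg e a -> bihom d f -> bihom (d + e) (fun_ract f a).
Proof.
move=> ha hf; split=> [x y|b x|b x|i x hx]; rewrite /fun_ract.
- by rewrite (bihomD hf) ractDl.
- by rewrite (bihomL hf) lractA.
- by rewrite (bihomR hf) -!ractM mulrC.
- by rewrite addrA; apply: gdegR => //; apply: bihom_deg hf _ _ _.
Qed.

Lemma hom_pred_bihom d (f : M -> N) : bihom d f -> f \in hom_pred.
Proof.
move=> h; apply/asboolP; exists [:: f]; rewrite big_seq1; split=> // g.
by rewrite inE => /eqP ->; exists d.
Qed.
Lemma hom_predD (f g : M -> N) :
  f \in hom_pred -> g \in hom_pred -> f + g \in hom_pred.
Proof.
move=> /asboolP[l [hl ->]] /asboolP[l' [hl' ->]]; apply/asboolP.
exists (l ++ l'); rewrite big_cat; split=> // h.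
by rewrite mem_cat => /orP[/hl|/hl'].
Qed.
Lemma hom_pred0 : (0 : M -> N) \in hom_pred.
Proof. exact: hom_pred_bihom (bihom_zero 0). Qed.
Lemma hom_pred_sum (I : eqType) (r : seq I) (F : I -> (M -> N)) :
  (forall i, i \in r -> F i \in hom_pred) -> \sum_(i <- r) F i \in hom_pred.
Proof.
move=> h; rewrite big_seq; elim/big_ind: _ => //; first exact: hom_pred0.
exact: hom_predD.
Qed.

Lemma hom_predZ a (f : M -> N) : f \in hom_pred -> a *: f \in hom_pred.
Proof.
move=> /asboolP[l [hl ->]]; have [la [hla ->]] := rdeg_split a.
rewrite scaler_suml; apply: hom_pred_sum => b /hla[e he].
rewrite scaler_sumr; apply: hom_pred_sum => g /hl[d hd].
exact: hom_pred_bihom (bihom_scale he hd).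
Qed.
Lemma hom_pred_ract a (f : M -> N) : f \in hom_pred -> fun_ract f a \in hom_pred.
Proof.
move=> /asboolP[l [hl ->]]; have [la [hla ->]] := rdeg_split a.
have -> : fun_ract (\sum_(g <- l) g) (\sum_(b <- la) b) =
          \sum_(b <- la) \sum_(g <- l) fun_ract g b.
  apply: funext => x; rewrite /fun_ract ract_sumr [RHS]fct_sumE.
  by apply: eq_bigr => b _; rewrite !fct_sumE ract_suml.
apply: hom_pred_sum => b /hla[e he]; apply: hom_pred_sum => g /hl[d hd].
exact: hom_pred_bihom (bihom_ract he hd).
Qed.

Lemma hom_submod_closed : submod_closed hom_pred.
Proof.
split; first exact: hom_pred0.
by move=> a f g hf hg; apply: hom_predD => //; apply: hom_predZ.
Qed.

HB.instance Definition _ :=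
  GRing.isSubmodClosed.Build R (M -> N) hom_pred hom_submod_closed.

Record homs := Homs { homs_fun :> M -> N; homs_funP : homs_fun \in hom_pred }.
HB.instance Definition _ := [isSub for homs_fun].
HB.instance Definition _ := [Choice of homs by <:].
HB.instance Definition _ := [SubChoice_isSubLmodule of homs by <:].

Definition homs_ract (f : homs) a : homs := Homs (hom_pred_ract a (homs_funP f)).

Lemma homs_inj (f g : homs) : (forall x, f x = g x) -> f = g.
Proof. by move=> h; apply: val_inj; apply: funext. Qed.

Program Definition hombim : gbimod :=
  @GBimod homs homs_ract (fun d (f : homs) => bihom d f)
    _ _ _ _ _ _ _ _ _ _ _ _.
Next Obligation. by apply: homs_inj => z; apply: ractDl. Qed.
Next Obligation. by apply: homs_inj => z; apply: ractDr. Qed.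
Next Obligation. by apply: homs_inj => z; apply: ract1. Qed.
Next Obligation. by apply: homs_inj => z; apply: ractM. Qed.
Next Obligation. by apply: homs_inj => z; apply: lractA. Qed.
Next Obligation. by apply: homs_inj => z; apply: ractC. Qed.
Next Obligation. exact: bihom_zero. Qed.
Next Obligation. by apply: bihom_add => //; apply: bihom_opp. Qed.
Next Obligation. exact: bihom_scale. Qed.
Next Obligation. exact: bihom_ract. Qed.
Next Obligation.
case: x => f hf; have /asboolP[l [hl e]] := hf.
suff [l' [hl' e']] : exists l' : seq homs,
    (forall g : homs, g \in l' -> exists d, bihom d g) /\
    f = \sum_(g <- l') (g : M -> N).
  by exists l'; split=> //; apply: val_inj; rewrite raddf_sum.
rewrite e; elim: l hl {e} => [|g l IH] hl.
  by exists [::]; rewrite !big_nil.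
have [|l' [hl' e']] := IH; first by move=> h hh; apply: hl; rewrite inE hh orbT.
have [d hd] := hl g (mem_head _ _).
exists (Homs (hom_pred_bihom hd) :: l'); rewrite !big_cons -e'; split=> //.
by move=> h; rewrite inE => /orP[/eqP ->|/hl' //]; exists d.
Qed.
Next Obligation.
have key i x : gdeg i x -> c d x = 0.
  move=> hx; have addi : injective (fun f : int => i + f) by apply: addrI.
  have ei f : i + f - i = f by rewrite addrC addKr.
  rewrite -[d]ei.
  apply: (@gdeg_sum0 N [seq i + f | f <- D] (fun f => c (f - i) x) _ _ _ (i + d)).
  - by rewrite map_inj_uniq.
  - by move=> f; have := bihom_deg (H0 (f - i)) hx; rewrite addrC subrK.
  - have := congr1 val H1; rewrite raddf_sum => /(congr1 (fun f : M -> N => f x)).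
    rewrite fct_sumE => h0; rewrite big_map -[RHS]h0.
    by apply: eq_bigr => f _; rewrite ei.
  - by rewrite (mem_map addi).
apply: homs_inj => x; have [l [hl ->]] := gdeg_split x.
by rewrite (bihom_sum _ _ (H0 d)) big_seq big1 // => y /hl[i]; apply: key.
Qed.

End Hom.

Lemma homs_map_subproof (B M N : gbimod) (f : ghom M N) (g : homs B M) :
  (f \o g : B -> N) \in @hom_pred B N.
Proof.
have /asboolP[l [hl e]] := homs_funP g.
have -> : (f \o g : B -> N) = \sum_(h <- l) (f \o h : B -> N).
  apply: funext => x; rewrite fct_sumE /= e fct_sumE.
  exact: bihom_sum (ghomP f).
apply: hom_pred_sum => h /hl[d hd].
exact: hom_pred_bihom (bihom_comp (ghomP f) hd).
Qed.
Program Definition homs_map (B M N : gbimod) (f : ghom M N) :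
    ghom (hombim B M) (hombim B N) :=
  @GHom (hombim B M) (hombim B N) (fun g => Homs (homs_map_subproof f g)) _.
Next Obligation.
split=> [g h|a g|a g|e g hg].
- by apply: homs_inj => x; apply: (bihomD (ghomP f)).
- by apply: homs_inj => x; apply: (bihomL (ghomP f)).
- by apply: homs_inj => x; apply: (bihomR (ghomP f)).
- exact: (bihom_comp (ghomP f) hg).
Qed.

Record gfunctor := GFunctor {
  fobj :> gbimod -> gbimod;
  fmap : forall M N, ghom M N -> ghom (fobj M) (fobj N);
  fmap_id : forall M, fmap (gid M) =1 idfun;
  fmap_comp : forall M N P (g : ghom N P) (f : ghom M N),
    fmap (gcomp_hom g f) =1 fmap g \o fmap f
}.

Program Definition ker_functor rho e (hrho : rdeg e rho) : gfunctor :=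
  @GFunctor (kerbim hrho) (ker_map hrho) _ _.
Next Obligation. by move=> x; apply: val_inj. Qed.
Next Obligation. by move=> x; apply: val_inj. Qed.

Program Definition hom_functor (B : gbimod) : gfunctor :=
  @GFunctor (hombim B) (@homs_map B) _ _.
Next Obligation. by move=> x; apply: homs_inj. Qed.
Next Obligation. by move=> x; apply: homs_inj. Qed.

Program Definition shift_functor (j : int) (F : gfunctor) : gfunctor :=
  @GFunctor (fun M => shift (F M) j)
    (fun M N f => @GHom (shift (F M) j) (shift (F N) j) (fmap F f) _) _ _.
Next Obligation.
have h := ghomP (fmap F f); split=> [x y|a x|a x|e x hx].
- exact: (bihomD h).
- exact: (bihomL h).
- exact: (bihomR h).
- by rewrite /= addrAC; apply: (bihom_deg h).
Qed.
Next Obligation. exact: fmap_id. Qed.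
Next Obligation. exact: fmap_comp. Qed.

Definition is_giso (M N : gbimod) (f : ghom M N) : Prop :=
  exists g : ghom N M, cancel f g /\ cancel g f.

(* Natural isomorphisms between the restrictions of F and G to the full       *)
(* subcategory of graded bimodules with objects in P.                         *)
Record nat_iso (P : gbimod -> Prop) (F G : gfunctor) := NatIso {
  nat_comp : forall M, P M -> ghom (F M) (G M);
  nat_isoP : forall M (hM : P M), is_giso (nat_comp hM);
  nat_natural : forall M N (hM : P M) (hN : P N) (f : ghom M N),
    nat_comp hN \o fmap F f =1 fmap G f \o nat_comp hM
}.

End Bimodules.

Arguments gbimod : clear implicits.

Definition gen : Type := bool.
Definition gs : gen := false.
Definition gt : gen := true.

(* The characteristic of a commutative ring being 0 means that n <> 0 in k for *)
(* all n > 0; [pchar k] only records the prime characteristics.               *)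
Definition char_zero (k : comUnitRingType) : Prop :=
  forall j : nat, (0 < j)%N -> j%:R != 0 :> k.

Definition qnum (k : comUnitRingType) (q : k) (j : nat) : k :=
  \sum_(i < j) q ^ (j%:Z - 1 - (2 * i)%:Z).

(* vectType k over a ring k: k-modules with an isomorphism to k^n for some n. *)
Section Realization.
Context {k : comUnitRingType} {V : vectType k}.
Local Notation Vdual := 'Hom(V, k^o).
Local Notation R := {mpoly k[dim V]}.

Variables (root : gen -> Vdual) (coroot : gen -> V).

Definition refl (u : gen) (v : V) : V := v - (root u v : k) *: coroot u.

Record symmetric_realization (m : nat) (q : k) : Prop := SymRealization {
  root_coroot : forall u, root u (coroot u) = 2 :> k;
  cartan_sym : root gt (coroot gs) = root gs (coroot gt);
  refl_invol : forall u v, refl u (refl u v) = v;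
  refl_braid : forall v, iter m (refl gs \o refl gt) v = v;
  q_unit : q \is a GRing.unit;
  cartan_q : root gt (coroot gs) = - (q + q^-1) :> k;
  qnum_m : qnum q m = 0
}.

Definition lin_indep2 (x y : Vdual) : Prop :=
  forall a b : k, a *: x + b *: y = 0 -> a = 0 /\ b = 0.

Definition fundamental_weights (rho : gen -> Vdual) : Prop :=
  forall u v, rho u (coroot v) = (u == v)%:R :> k.

(* The symmetric algebra of the dual of V is the polynomial ring on the        *)
(* coordinate functions for the basis provided by the vectType structure.     *)
Definition vbase (i : 'I_(dim V)) : V := VectorInternalTheory.r2v 'e_i.
Definition vcoord (i : 'I_(dim V)) : Vdual :=
  linfun (fun v : V => VectorInternalTheory.v2r v 0 i : k^o).
Definition symV (x : Vdual) : R := \sum_i (x (vbase i) : k) *: 'X_i.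

(* The contragredient action on the dual of V, extended to an algebra         *)
(* endomorphism of R.                                                         *)
Definition dual_refl (u : gen) (x : Vdual) : Vdual :=
  x - (x (coroot u) : k) *: root u.
Definition sym_refl (u : gen) (p : R) : R :=
  p \mPo [tuple symV (dual_refl u (vcoord i)) | i < dim V].

Lemma symV_homog x : symV x \is 1.-homog.
Proof.
by apply: rpred_sum => i _; apply: rpredZ; rewrite dhomogX /= mdeg1.
Qed.
Lemma symV_deg x : rdeg 2 (symV x).
Proof. exact: rdeg_homog (symV_homog x). Qed.

Lemma sym_refl_homog u j p : p \is j.-homog -> sym_refl u p \is j.-homog.
Proof.
move=> hp; rewrite /sym_refl comp_mpolyE big_seq; apply: rpred_sum => m hm.
apply: rpredZ; rewrite -(dhomog_mf hp hm) /= mdegE.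
elim/big_ind2: _ => [|a i b j' ha hb|i _]; first exact: dhomog1.
  exact: dhomogM.
rewrite tnth_mktuple; set x := dual_refl _ _.
by have := dhomogMn (m i) (symV_homog x); rewrite mul1n.
Qed.

Lemma inv_split u p : sym_refl u p = p -> exists l : seq R,
  (forall b, b \in l -> sym_refl u b = b /\ exists d, rdeg d b) /\
  p = \sum_(b <- l) b.
Proof.
move=> hp; exists [seq pihomog mdeg j p | j <- iota 0 (msize p)].
have e : p = \sum_(j <- iota 0 (msize p)) pihomog mdeg j p.
  rewrite {1}(@pihomog_partitionE _ _ mdeg (msize p) p) //.
  by rewrite -(big_mkord xpredT (fun i => pihomog mdeg i p)) /index_iota subn0.
split; last by rewrite big_map.
move=> b /mapP[j hj ->]; split; last first.
  by exists (2 * j)%:Z; apply/rdeg_homog/pihomogP.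
have L : sym_refl u p = \sum_(i <- iota 0 (msize p)) sym_refl u (pihomog mdeg i p).
  by rewrite {1}e /sym_refl raddf_sum.
rewrite -[in RHS]hp L raddf_sum /= (bigD1_seq j) ?iota_uniq //= big1 ?addr0.
  by rewrite [RHS]pihomog_dE //; apply: (sym_refl_homog u (pihomogP _ _ _)).
move=> i ni; apply: (pihomog_ne0 ni).
by apply: (sym_refl_homog u (pihomogP _ _ _)).
Qed.

(* The u-invariants of R. *)
Definition Rinv (u : gen) : hset := HSet (@inv_split u).

Lemma Rinv_const u (c : k) : Rinv u c%:MP.
Proof. exact: comp_mpolyC. Qed.

(* B_u = R (x)_{R^u} R (1) *)
Definition Bbim (u : gen) : gbimod k (dim V) :=
  shift (tensor Rbim Rbim (Rinv_const u)) 1.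

(* The objects of SBim(h, W_I), for W_I generated by the reflections in I.     *)
(* Closure under direct summands gives idempotent completeness and, taking    *)
(* i and p mutually inverse, closure under isomorphism.                       *)
Inductive SBim (I : gen -> Prop) : gbimod k (dim V) -> Prop :=
| SBim_unit : SBim I Rbim
| SBim_gen u : I u -> SBim I (Bbim u)
| SBim_tensor M N : SBim I M -> SBim I N -> SBim I (tensorR M N)
| SBim_dsum M N : SBim I M -> SBim I N -> SBim I (dsum M N)
| SBim_shift M j : SBim I M -> SBim I (shift M j)
| SBim_summand M N (i : ghom N M) (p : ghom M N) :
    cancel i p -> SBim I M -> SBim I N.

(* pi_s^-, with rho = rho_s *)
Definition pi_minus (rho : Vdual) : gfunctor := ker_functor (@symV_deg rho).

End Realization.

(* Main.v *)
Require Import Defs.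
From HB Require Import structures.
From mathcomp Require Import all_boot all_order all_algebra.
From mathcomp Require Import boolp functions ring.
From mathcomp Require Import ssrcomplements freeg mpoly.

Set Implicit Arguments.
Unset Strict Implicit.
Unset Printing Implicit Defensive.

Import GRing.Theory VectorInternalTheory.
Local Open Scope ring_scope.

(** Write R for the symmetric algebra and R^t, R^W for the invariants of t and
    of the whole dihedral group. The shift in B_t(-1) cancels the one in B_t, so
    that B_t(-1) is R (x)_{R^t} R with its cyclic generator 1 (x) 1 in degree 0.
    Evaluation at 1 (x) 1 therefore identifies Hom(B_t(-1), M), as a graded
    bimodule and naturally in M, with the elements x of M such that r x = x r
    for every r in R^t ([extend_one], [homs_ext]). The claim is that, for M in
    SBim, these are already all the elements commuting with rho_s.

    One inclusion holds because rho_s is t-invariant. For the other, r x = x r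
    for every r in R^W, whatever x in M ([SBim_invariant_symmetric]); and the r
    that commute with a given x form a subalgebra. So it suffices that
    R^t = R^W[rho_s] ([invariants_generated]).

    That equality comes down to a single quadratic element. Let U be the space
    of linear forms vanishing on both coroots; it is fixed pointwise by W, and
    V^* = k rho_s + k rho_t + U. Hence R is generated by rho_t over the
    subalgebra A generated by rho_s, U and
      N = rho_t (alpha_t - rho_t) = - rho_t t(rho_t),
    and rho_t is a root of a monic quadratic polynomial over A. So R is
    A + A rho_t. As t fixes A pointwise and rho_t - t(rho_t) = alpha_t, an element
    p + q rho_t is t-invariant only if q alpha_t = 0, that is q = 0
    ([mpoly_mccoy]); hence R^t = A. Finally the W-invariant quadratic form
    attached to the Cartan matrix differs from N by a multiple of rho_s in
    k[rho_s, U], which puts N in R^W[rho_s]. *)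

(** * Regular elements of polynomial rings *)

(** McCoy's theorem. The ring k may have zero divisors, so a nonzero linear form
    need not be regular; what is required is that no nonzero scalar kills it.
    For an annihilator f of g with the fewest monomials, the leading coefficient
    of any h with h f = 0 kills the leading term of f, hence kills f by
    minimality. Peeling off the leading terms of g, every coefficient of g kills
    f, and then the leading coefficient of f kills g. *)
Lemma mpoly_mccoy (k : comNzRingType) (n : nat) (g f : {mpoly k[n]}) :
  (forall a : k, a *: g = 0 -> a = 0) -> g * f = 0 -> f = 0.
Proof.
move=> faithful_g.
have [N] := ubnP (size (msupp f)).
elim: N => // N IH in f *; rewrite ltnS => le_fN gf0.
apply/eqP/contraT => nz_f.
have kills h : h * f = 0 -> forall mu, h@_mu *: f = 0.
  have [K] := ubnP (size (msupp h)).
  elim: K => // K IHh in h *; rewrite ltnS => le_hK hf0 mu.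
  have [-> | nz_h] := eqVneq h 0; first by rewrite mcoeff0 scale0r.
  set c := mleadc h.
  (* c f is again annihilated by g, and has lost the leading monomial of f. *)
  have cf0 : c *: f = 0.
    apply: IH; last by rewrite -scalerAr gf0 scaler0.
    apply: leq_trans le_fN.
    have sub : {subset msupp (c *: f) <= rem (mlead f) (msupp f)}.
      move=> nu nu_cf; rewrite mem_rem_uniq ?msupp_uniq // inE /=.
      rewrite (msuppZ_le nu_cf) andbT.
      apply: contraTneq nu_cf => ->.
      by rewrite mcoeff_msupp mcoeffZ -mleadcM hf0 mcoeff0 eqxx.
    have := uniq_leq_size (msupp_uniq _) sub.
    rewrite size_rem ?mlead_supp // => /leq_ltn_trans; apply.
    by rewrite prednK // lt0n size_eq0 msupp_eq0.
  have [-> // | ne_mu] := eqVneq mu (mlead h).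
  set h' := h - c *: 'X_[mlead h].
  have h'E nu : h'@_nu = if nu == mlead h then 0 else h@_nu.
    rewrite mcoeffB mcoeffZ mcoeffX eq_sym.
    by case: eqP => [->|_]; rewrite ?mulr1 ?mulr0 ?subrr ?subr0.
  suff h'_kills : forall nu, h'@_nu *: f = 0.
    by have := h'_kills mu; rewrite h'E (negbTE ne_mu).
  apply: IHh; last first.
    by rewrite mulrBl hf0 -scalerAl scalerAr cf0 mulr0 subrr.
  apply: leq_trans le_hK.
  have sub : {subset msupp h' <= rem (mlead h) (msupp h)}.
    move=> nu; rewrite mem_rem_uniq ?msupp_uniq // inE /=.
    by rewrite !mcoeff_msupp h'E; case: (nu == _); rewrite ?eqxx.
  have := uniq_leq_size (msupp_uniq _) sub.
  rewrite size_rem ?mlead_supp // => /leq_ltn_trans; apply.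
  by rewrite prednK // lt0n size_eq0 msupp_eq0.
have lead0 : mleadc f = 0.
  apply: faithful_g; apply/mpolyP => mu.
  by rewrite mcoeffZ mcoeff0 mulrC -mcoeffZ kills // mcoeff0.
by move: nz_f; rewrite -mleadc_eq0 lead0 eqxx.
Qed.

(** * Subalgebras *)

Record is_subalgebra (k : comNzRingType) (n : nat)
    (A : {mpoly k[n]} -> Prop) : Prop := IsSubalgebra {
  subalgC : forall c : k, A c%:MP;
  subalgD : forall p r, A p -> A r -> A (p + r);
  subalgM : forall p r, A p -> A r -> A (p * r)
}.

Section Subalgebras.
Variables (k : comNzRingType) (n : nat).
Implicit Types (A : {mpoly k[n]} -> Prop) (p q : {mpoly k[n]}).

Lemma subalgI A A' : is_subalgebra A -> is_subalgebra A' ->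
  is_subalgebra (fun p => A p /\ A' p).
Proof.
move=> hA hA'; split=> [c | p r [] ? ? [] ? ? | p r [] ? ? [] ? ?].
- by split; apply: subalgC.
- by split; apply: subalgD.
- by split; apply: subalgM.
Qed.

Lemma subalgZ A (c : k) p : is_subalgebra A -> A p -> A (c *: p).
Proof.
by move=> hA hp; rewrite -mul_mpolyC; apply: subalgM => //; apply: subalgC.
Qed.

Lemma subalgN A p : is_subalgebra A -> A p -> A (- p).
Proof. by move=> hA hp; rewrite -scaleN1r; apply: subalgZ. Qed.

Lemma subalgB A p q : is_subalgebra A -> A p -> A q -> A (p - q).
Proof. by move=> hA hp hq; apply: subalgD => //; apply: subalgN. Qed.

(** The module A + A y contains 1 and the variables, and is stable under products
    because y satisfies a monic quadratic equation over A: it is everything. *)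
Lemma quadratic_decomposition A y b c : is_subalgebra A ->
  A b -> A c -> y * y = c + b * y ->
  (forall i, exists p q, [/\ A p, A q & 'X_i = p + q * y]) ->
  forall r, exists p q, [/\ A p, A q & r = p + q * y].
Proof.
move=> hA hb hc yy hX.
pose span r := exists p q, [/\ A p, A q & r = p + q * y].
have A0 : A 0 by rewrite -mpolyC0; apply: subalgC.
have spanC a : span a%:MP.
  by exists a%:MP, 0; rewrite mul0r addr0; split=> //; apply: subalgC.
have span1 : span 1 by rewrite -mpolyC1; apply: spanC.
have spanM f g : span f -> span g -> span (f * g).
  move=> [p [q [hp hq ->]]] [p' [q' [hp' hq' ->]]].
  exists (p * p' + q * q' * c), (p * q' + q * p' + q * q' * b); split.
  - by apply: subalgD => //; do ?apply: subalgM.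
  - by do ?apply: subalgD => //; do ?apply: subalgM.
  - by transitivity (p * p' + (p * q' + q * p') * y + q * q' * (y * y));
      [ring | rewrite yy; ring].
have spanD f g : span f -> span g -> span (f + g).
  move=> [p [q [hp hq ->]]] [p' [q' [hp' hq' ->]]].
  exists (p + p'), (q + q'); split; [exact: subalgD | exact: subalgD | ring].
move=> r; rewrite -/(span r) (mpolyE r); elim/big_ind: _ => //.
  by rewrite -mpolyC0; apply: spanC.
move=> mu _; rewrite -mul_mpolyC; apply: (spanM _ _ (spanC _)).
rewrite mpolyXE_id; elim/big_ind: _ => // i _.
elim: (mu i) => [|e IH]; first by rewrite expr0.
by rewrite exprS; apply: spanM.
Qed.

End Subalgebras.

(** * The action of the reflections on the symmetric algebra *)

Section SymmetricAlgebra.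
Variables (k : comUnitRingType) (V : vectType k).
Implicit Types xi : 'Hom(V, k^o).

Lemma symV_is_linear : linear (@symV k V).
Proof.
move=> a x y; rewrite /symV scaler_sumr -big_split /=; apply: eq_bigr => i _.
by rewrite add_lfunE scale_lfunE scalerDl scalerA.
Qed.
HB.instance Definition _ := GRing.isLinear.Build k 'Hom(V, k^o)
  {mpoly k[dim V]} _ (@symV k V) symV_is_linear.

Lemma vcoordE i (v : V) : vcoord i v = v2r v 0 i.
Proof.
pose c (v : V) : k^o := v2r v 0 i.
have lin_c : linear c by move=> a u w; rewrite /c linearP !mxE.
pose cl := HB.pack_for {linear V -> k^o} c
  (GRing.isLinear.Build k V k^o *:%R c lin_c).
exact: (lfunE cl v).
Qed.

Lemma vcoord_vbase i j : vcoord i (vbase j : V) = (i == j)%:R :> k.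
Proof. by rewrite vcoordE /vbase r2vK mxE eqxx. Qed.

Lemma symV_vcoord i : symV (vcoord i : 'Hom(V, k^o)) = 'X_i.
Proof.
rewrite /symV (bigD1 i) //= vcoord_vbase eqxx scale1r big1 ?addr0 // => j ne.
by rewrite vcoord_vbase eq_sym (negbTE ne) scale0r.
Qed.

Lemma lfun_vbase_eq xi xi' :
  (forall i, xi (vbase i) = xi' (vbase i)) -> xi = xi'.
Proof.
move=> h; apply/lfunP => v.
rewrite -[v]v2rK (row_sum_delta (v2r v)).
rewrite !linear_sum; apply: eq_bigr => i _.
by rewrite !linearZ /= -/(vbase i) h.
Qed.

Lemma lfun_vcoord xi : xi = \sum_i (xi (vbase i) : k) *: vcoord i.
Proof.
apply: lfun_vbase_eq => j; rewrite sum_lfunE (bigD1 j) //= big1 => [|i ne].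
  by rewrite addr0 scale_lfunE vcoord_vbase eqxx [_ *: _]mulr1.
by rewrite scale_lfunE vcoord_vbase (negbTE ne) [_ *: _]mulr0.
Qed.

Lemma symV_inj : injective (@symV k V).
Proof.
move=> x y eq_xy; apply: lfun_vbase_eq => j.
have coefE z : (symV z)@_(U_(j))%MM = z (vbase j) :> k.
  rewrite /symV raddf_sum (bigD1 j) //= mcoeffZ mcoeffXU eqxx mulr1.
  by rewrite big1 ?addr0 // => i ne; rewrite mcoeffZ mcoeffXU (negbTE ne) mulr0.
by rewrite -!coefE eq_xy.
Qed.

Variables (root : gen -> 'Hom(V, k^o)) (coroot : gen -> V).
Local Notation refl := (sym_refl root coroot).

Lemma sym_reflD u p r : refl u (p + r) = refl u p + refl u r.
Proof. exact: comp_mpolyD. Qed.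
Lemma sym_reflM u p r : refl u (p * r) = refl u p * refl u r.
Proof. exact: rmorphM. Qed.

Lemma sym_refl_symV u xi :
  refl u (symV xi) = symV xi - (xi (coroot u) : k) *: symV (root u).
Proof.
have dualE : dual_refl root coroot u xi =
    \sum_i (xi (vbase i) : k) *: dual_refl root coroot u (vcoord i).
  rewrite [in LHS](lfun_vcoord xi) /dual_refl sum_lfunE scaler_suml -sumrB.
  by apply: eq_bigr => i _; rewrite scale_lfunE scalerBr scalerA.
transitivity (symV (dual_refl root coroot u xi)); last by rewrite linearB linearZ.
rewrite dualE linear_sum {1}/symV /sym_refl raddf_sum; apply: eq_bigr => i _ /=.
by rewrite comp_mpolyZ comp_mpolyXU linearZ -tnth_nth tnth_mktuple.
Qed.

Lemma sym_refl_invariants u : is_subalgebra (fun p => refl u p = p).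
Proof.
split=> [c | p r ep er | p r ep er]; first exact: comp_mpolyC.
  by rewrite sym_reflD ep er.
by rewrite sym_reflM ep er.
Qed.

(** * Generators of the invariants of a simple reflection *)

Section Dihedral.
Variable rho : gen -> 'Hom(V, k^o).
Hypothesis root_coroot : forall u, root u (coroot u) = 2 :> k.
Hypothesis cartan_sym : root gt (coroot gs) = root gs (coroot gt).
Hypothesis rhoP : fundamental_weights coroot rho.
Hypothesis root_regular : forall a : k, a *: root gt = 0 -> a = 0.

Let a : k := root gt (coroot gs).
Let xs := symV (rho gs).
Let xt := symV (rho gt).
Let als := symV (root gs).
Let alt := symV (root gt).

(** In terms of the coordinates rho_s, rho_t and the components u_s, u_t of the
    roots on the forms vanishing on both coroots, this is
      rho_s^2 + a rho_s rho_t + rho_t^2 + u_s rho_s + u_t rho_t,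
    half of the invariant quadratic form when u_s = u_t = 0. *)
Definition dihedral_quadric :=
  xs * als + xt * alt - xs * xs - xt * xt - a *: (xs * xt).

Lemma refl_rho u v :
  refl u (symV (rho v)) = symV (rho v) - (v == u)%:R *: symV (root u).
Proof. by rewrite sym_refl_symV rhoP. Qed.

Lemma dihedral_quadric_inv u : refl u dihedral_quadric = dihedral_quadric.
Proof.
have rB p r : refl u (p - r) = refl u p - refl u r by exact: comp_mpolyB.
rewrite /dihedral_quadric !rB !sym_reflD [refl u (a *: _)]comp_mpolyZ -/(refl u _).
rewrite !sym_reflM !refl_rho !sym_refl_symV.
case: u {rB}; rewrite /= ?root_coroot -?cartan_sym -/a -!mul_mpolyC -/xs -/xt -/als -/alt;
  rewrite ?(rmorph1, rmorph0); ring.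
Qed.


(** R^t is generated as an algebra by R^W and rho_s. The proof takes for A' the
    t-invariant part of A and shows that R = A' + A' rho_t, so that a
    t-invariant element, having no rho_t component, lies in A'. *)
Lemma invariants_generated (A : {mpoly k[dim V]} -> Prop) :
  is_subalgebra A -> A xs ->
  (forall r, (forall u, refl u r = r) -> A r) ->
  forall r, refl gt r = r -> A r.
Proof.
move=> hA A_xs A_inv.
pose A' r := A r /\ refl gt r = r.
have hA' : is_subalgebra A' by apply: subalgI => //; apply: sym_refl_invariants.
have A'xs : A' xs by split=> //; rewrite refl_rho scale0r subr0.
have A'_lin xi : xi (coroot gt) = 0 :> k -> A' (symV xi).
  move=> xi_t.
  (* Removing the rho_s component leaves a form vanishing on both coroots,
     which every reflection fixes. *)
  pose c : k := xi (coroot gs).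
  have -> : symV xi = c *: xs + symV (xi - c *: rho gs).
    by rewrite linearB linearZ addrC subrK.
  apply: subalgD => //; first exact: subalgZ.
  have inv u : refl u (symV (xi - c *: rho gs)) = symV (xi - c *: rho gs).
    rewrite sym_refl_symV; case: u; rewrite add_lfunE opp_lfunE scale_lfunE rhoP /=.
      by rewrite [c *: 0]mulr0 xi_t subr0 scale0r subr0.
    by rewrite [c *: 1]mulr1 subrr scale0r subr0.
  by split=> //; apply: A_inv.
(* N is minus the product of rho_t and its image under t. *)
pose N := xt * alt - xt * xt.
have A'N : A' N.
  have -> : N = dihedral_quadric - xs * symV (root gs - rho gs - a *: rho gt).
    rewrite !linearB linearZ /= /dihedral_quadric /N -/xs -/xt -/als -/alt.
    rewrite -!mul_mpolyC; ring.
  apply: subalgB => //.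
    by split; [apply: A_inv => u|]; apply: dihedral_quadric_inv.
  apply: subalgM => //; apply: A'_lin.
  rewrite !(add_lfunE, opp_lfunE) scale_lfunE !rhoP /= -cartan_sym -/a subr0.
  by rewrite [a *: 1]mulr1 subrr.
have A'b : A' (symV (2 *: rho gt - root gt)).
  apply: A'_lin; rewrite add_lfunE opp_lfunE scale_lfunE rhoP /= root_coroot.
  by rewrite [2 *: 1]mulr1 subrr.
have xt_sq : xt * xt = N + symV (2 *: rho gt - root gt) * xt.
  rewrite linearB linearZ /= -/xt -/alt /N -mul_mpolyC rmorph_nat; ring.
have X_dec i : exists p q, [/\ A' p, A' q & 'X_i = p + q * xt].
  pose c : k := vcoord i (coroot gt).
  exists (symV (vcoord i - c *: rho gt)), c%:MP; split.
  - apply: A'_lin; rewrite add_lfunE opp_lfunE scale_lfunE rhoP /=.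
    by rewrite [c *: 1]mulr1 subrr.
  - exact: subalgC.
  - by rewrite mul_mpolyC linearB linearZ /= symV_vcoord subrK.
move=> r r_inv.
have [p [q [[Ap p_inv] [_ q_inv] def_r]]] :=
  quadratic_decomposition hA' A'b A'N xt_sq X_dec r.
(* Subtracting the image under t leaves q * alt = 0. *)
suff q0 : q = 0 by rewrite def_r q0 mul0r addr0.
apply: (@mpoly_mccoy _ _ alt).
  move=> c c_alt; apply: root_regular; apply: symV_inj.
  by rewrite linearZ /= linear0.
move: r_inv; rewrite def_r sym_reflD sym_reflM p_inv q_inv refl_rho eqxx scale1r.
by move=> /addrI; rewrite mulrBr -[RHS]subr0 => /addrI /oppr_inj; rewrite mulrC.
Qed.

End Dihedral.
End SymmetricAlgebra.

(** * Symmetric scalars and homomorphisms of bimodules *)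

Section Bimodules.
Variables (k : comNzRingType) (n : nat).
Local Notation R := {mpoly k[n]}.
Implicit Types (M N B : gbimod k n) (r : R).

Lemma commutant_subalgebra M (x : M) :
  is_subalgebra (fun r => r *: x = ract x r).
Proof.
split=> [c | r r' hr hr' | r r' hr hr']; first by rewrite ractC.
  by rewrite scalerDl ractDr hr hr'.
by rewrite ractM -hr -lractA -hr' scalerA.
Qed.

Definition symmetric_scalar M r := forall x : M, r *: x = ract x r.

(** In M (x)_S N a scalar of S passes through M, the tensor sign and N in turn,
    so that it acts in the same way on the left and on the right. *)
Lemma symmetric_scalar_tensor (S : hset) (hS : forall c : k, S c%:MP) M N r :
  symmetric_scalar M r -> symmetric_scalar N r -> S r ->
  symmetric_scalar (tensor M N hS) r.
Proof.
move=> hM hN hr t; change (tscale r t = tract t r).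
move: t; apply: tens_ext => [t u|t u|x y].
- exact: tscaleDr.
- exact: tractDl.
- by rewrite tscale_tau tract_tau hM tau_bal // hN.
Qed.

Lemma homsD M N (f : homs M N) x y : f (x + y) = f x + f y.
Proof.
have /asboolP[l [hl ->]] := homs_funP f; rewrite !fct_sumE -big_split.
by apply: eq_big_seq => g /hl[d hg]; apply: bihomD hg _ _.
Qed.
Lemma homsL M N (f : homs M N) r x : f (r *: x) = r *: f x.
Proof.
have /asboolP[l [hl ->]] := homs_funP f; rewrite !fct_sumE scaler_sumr.
by apply: eq_big_seq => g /hl[d hg]; apply: bihomL hg _ _.
Qed.
Lemma homsR M N (f : homs M N) r x : f (ract x r) = ract (f x) r.
Proof.
have /asboolP[l [hl ->]] := homs_funP f; rewrite !fct_sumE ract_suml.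
by apply: eq_big_seq => g /hl[d hg]; apply: bihomR hg _ _.
Qed.

Lemma bihom_shiftl M N j d (f : M -> N) :
  @bihom _ _ (shift M j) N d f <-> @bihom _ _ M N (d - j) f.
Proof.
split=> hf; split; try exact: (bihomD hf);
  try exact: (bihomL hf); try exact: (bihomR hf).
  move=> e x hx; have -> : e + (d - j) = (e - j) + d by ring.
  by apply: (bihom_deg hf); rewrite /= subrK.
move=> e x /(bihom_deg hf).
by have -> : e + j + (d - j) = e + d by ring.
Qed.

Lemma hom_pred_shiftl M N j (f : M -> N) :
  f \in @hom_pred _ _ (shift M j) N <-> f \in @hom_pred _ _ M N.
Proof.
split=> /asboolP[l [hl ->]]; apply/asboolP; exists l; split=> // g /hl[d hg].
  by exists (d - j); apply/bihom_shiftl.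
by exists (d + j); apply/bihom_shiftl; rewrite addrK.
Qed.

Section ShiftHom.
Variables (P : gbimod k n -> Prop) (B : gbimod k n) (j : int).

Lemma unshift_hom_subproof M (f : homs (shift B (- j)) M) :
  (f : B -> M) \in @hom_pred _ _ B M.
Proof. exact: (proj1 (hom_pred_shiftl _ _) (homs_funP f)). Qed.
Lemma shift_hom_subproof M (f : homs B M) :
  (f : B -> M) \in @hom_pred _ _ (shift B (- j)) M.
Proof. exact: (proj2 (hom_pred_shiftl _ _) (homs_funP f)). Qed.

Definition unshift_hom M (f : homs (shift B (- j)) M) : homs B M :=
  Homs (unshift_hom_subproof f).
Definition shift_hom M (f : homs B M) : homs (shift B (- j)) M :=
  Homs (shift_hom_subproof f).

Lemma unshift_homP M :
  @bihom _ _ (hombim (shift B (- j)) M) (shift (hombim B M) j) 0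
    (@unshift_hom M).
Proof.
split=> [f g|r f|r f|e f hf]; try exact: homs_inj.
by move/bihom_shiftl: hf; rewrite opprK addr0.
Qed.
Lemma shift_homP M :
  @bihom _ _ (shift (hombim B M) j) (hombim (shift B (- j)) M) 0
    (@shift_hom M).
Proof.
split=> [f g|r f|r f|e f hf]; try exact: homs_inj.
by apply/bihom_shiftl; rewrite opprK addr0.
Qed.

(** The components are identities on functions; the definition is transparent so
    that this can be read off by computation. *)
Definition hom_shift_iso : nat_iso P (hom_functor (shift B (- j)))
                                     (shift_functor j (hom_functor B)).
Proof.
apply: (@NatIso _ _ P (hom_functor (shift B (- j)))
  (shift_functor j (hom_functor B)) (fun M _ => GHom (@unshift_homP M))).
  by move=> M _; exists (GHom (@shift_homP M)); split=> f; apply: homs_inj.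
by move=> M N _ _ f g; apply: homs_inj.
Defined.

End ShiftHom.

(** * The functor represented by R (x)_S R *)

Section Representing.
Variables (S : hset) (hS : forall c : k, @hset_mem k n S c%:MP).
Let T := tensor (@Rbim k n) (@Rbim k n) hS.

Definition tens1 : T := tau S (1 : @Rbim k n) (1 : @Rbim k n).

Lemma tau_tens1 (r r' : @Rbim k n) :
  tau S r r' = ract (r *: tens1) r' :> T.
Proof.
rewrite /tens1 /= -[r *: _]/(tscale _ _) tscale_tau tract_tau /=.
by rewrite [r *: _]mulr1 mul1r.
Qed.

Lemma tens1_central r : S r -> r *: tens1 = ract tens1 r.
Proof.
move=> hr; rewrite /tens1 /= -[r *: _]/(tscale _ _) tscale_tau tract_tau.
by rewrite /= [r *: _]mulr1 -[in LHS](mul1r r) (tau_bal (M := Rbim)) //= [_ *: _]mulr1 mul1r.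
Qed.

Lemma tens1_deg : gdeg 0 tens1.
Proof.
have one_deg : @gdeg _ _ (@Rbim k n) 0 1.
  exact: (rdeg_homog (dhomog1 _ _)).
by rewrite -[0]addr0; apply: tdeg_tau.
Qed.

Definition central M (x : M) := forall r, S r -> r *: x = ract x r.

(** The bimodule map with value x at 1 (x) 1; it is well defined when x is
    central, by [extend_one_balanced]. *)
Definition extend_one M (x : M) : T -> M :=
  tlift (fun r r' : @Rbim k n => ract ((r : R) *: x) (r' : R)).

Section Extend.
Variables (M : gbimod k n) (x : M).
Hypothesis xS : central x.

Lemma extend_one_balanced :
  balanced S (fun r r' : @Rbim k n => ract ((r : R) *: x) (r' : R)).
Proof.
split=> [r r' y | r y y' | r a y ha].
- by rewrite scalerDl ractDl.
- by rewrite ractDr.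
- by rewrite /= -scalerA xS // ractM lractA.
Qed.

Lemma extend_one_tau (r r' : @Rbim k n) :
  extend_one x (tau S r r') = ract ((r : R) *: x) (r' : R).
Proof. exact: tlift_tau extend_one_balanced. Qed.

Lemma extend_oneD t u : extend_one x (t + u) = extend_one x t + extend_one x u.
Proof. exact: tliftD extend_one_balanced. Qed.

Lemma extend_oneL r t : extend_one x (r *: t) = r *: extend_one x t.
Proof.
change (extend_one x (tscale r t) = r *: extend_one x t).
move: t; apply: tens_ext => [u v|u v|a b].
- by rewrite tscaleDr extend_oneD.
- by rewrite extend_oneD scalerDr.
- by rewrite tscale_tau !extend_one_tau -scalerA lractA.
Qed.

Lemma extend_oneR r t : extend_one x (ract t r) = ract (extend_one x t) r.
Proof.
change (extend_one x (tract t r) = ract (extend_one x t) r).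
move: t; apply: tens_ext => [u v|u v|a b].
- by rewrite tractDl extend_oneD.
- by rewrite extend_oneD ractDl.
- by rewrite tract_tau !extend_one_tau /= ractM.
Qed.

Lemma extend_one1 : extend_one x tens1 = x.
Proof. by rewrite extend_one_tau scale1r ract1. Qed.

Lemma extend_one_bihom d : gdeg d x -> bihom d (extend_one x).
Proof.
move=> hx; split; first exact: extend_oneD.
- exact: extend_oneL.
- exact: extend_oneR.
move=> e t; apply: (@tdeg_ind _ _ S Rbim Rbim e
  (fun t => gdeg (e + d) (extend_one x t))) => [|t' u ht hu|i j r r' <- hr hr'].
- have -> : extend_one x 0 = 0.
    by apply: (addrI (extend_one x 0)); rewrite -extend_oneD !addr0.
  exact: gdeg0.
- by rewrite extend_oneD; apply: gdegD.
rewrite extend_one_tau; have -> : i + j + d = d + i + j by ring.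
by apply: gdegR => //; apply: gdegL.
Qed.

End Extend.

Lemma extend_one_map M N (f : ghom M N) (x : M) :
  central x -> forall t, f (extend_one x t) = extend_one (f x) t.
Proof.
move=> xS; have fxS : central (f x).
  by move=> r hr; rewrite -(bihomL (ghomP f)) -(bihomR (ghomP f)) xS.
apply: (@tens_ext _ _ _ _ _ _ (f \o extend_one x)) => [t u|t u|r r'] /=.
- by rewrite extend_oneD // (bihomD (ghomP f)).
- by rewrite extend_oneD.
- by rewrite !extend_one_tau // (bihomR (ghomP f)) (bihomL (ghomP f)).
Qed.

Variables (P : gbimod k n -> Prop) (rho : R) (e : int) (hrho : rdeg e rho).
Hypothesis rhoS : S rho.
Hypothesis rho_central : forall M, P M -> forall x : M,
  rho *: x = ract x rho -> central x.
Variable j : int.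
Let B := shift (shift T j) (- j).

Section Component.
Variables (M : gbimod k n) (PM : P M).
Implicit Types x : ker rho M.

Lemma ker_central x : central (x : M).
Proof. exact: (rho_central PM (kerE x)). Qed.

(** An element of the kernel is a sum of homogeneous elements of the kernel, each
    of which extends to a homogeneous bimodule map. *)
Lemma ker_hom_subproof x : extend_one (x : M) \in @hom_pred _ _ B M.
Proof.
apply/hom_pred_shiftl/hom_pred_shiftl.
have [l [hl ->]] := @gdeg_split _ _ (kerbim hrho M) x.
have -> : extend_one ((\sum_(y <- l) y : ker rho M) : M) =
          \sum_(y <- l) extend_one (y : M).
  apply: funext; apply: tens_ext => [t u|t u|r r'].
  - by apply: extend_oneD; apply: ker_central.
  - rewrite !fct_sumE -big_split; apply: eq_bigr => y _.
    by apply: extend_oneD; apply: ker_central.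
  - rewrite fct_sumE extend_one_tau; last exact: ker_central.
    have -> : ker_val (\sum_(y <- l) y) = \sum_(y <- l) ker_val y.
      exact: (raddf_sum val).
    rewrite scaler_sumr ract_suml; apply: eq_bigr => y _.
    by rewrite extend_one_tau //; apply: ker_central.
apply: hom_pred_sum => y /hl[d hy]; apply: (@hom_pred_bihom _ _ T M d).
by apply: extend_one_bihom => //; apply: ker_central.
Qed.

Definition ker_hom x : homs B M := Homs (ker_hom_subproof x).

Lemma hom_ker_subproof (f : homs B M) : f tens1 \in ker_pred rho (M := M).
Proof.
by rewrite inE -(homsL f) -(homsR f) /= [X in f X]tens1_central.
Qed.
Definition hom_ker (f : homs B M) : ker rho M := Ker (hom_ker_subproof f).

(** 1 (x) 1 generates R (x)_S R as a bimodule. *)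
Lemma homs_ext (f g : homs B M) : f tens1 = g tens1 -> f = g.
Proof.
move=> fg; apply: homs_inj.
apply: (@tens_ext _ _ S Rbim Rbim) => [t u|t u|r r']; try exact: homsD.
rewrite tau_tens1.
transitivity (ract (r *: f tens1) r').
  by rewrite -homsL -homsR.
by rewrite fg -homsL -homsR.
Qed.

Lemma ker_homK : cancel ker_hom hom_ker.
Proof. by move=> x; apply: val_inj; apply/extend_one1/ker_central. Qed.
Lemma hom_kerK : cancel hom_ker ker_hom.
Proof. by move=> f; apply: homs_ext; apply/extend_one1/(ker_central (hom_ker f)). Qed.

Lemma hom_kerP : @bihom _ _ (hombim B M) (kerbim hrho M) 0 hom_ker.
Proof.
split=> [f g|r f|r f|d f hf]; try exact: val_inj.
rewrite /= addr0 -[d]add0r; apply: (bihom_deg hf).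
by rewrite /B /= subrK; apply: tens1_deg.
Qed.
Lemma ker_homP : @bihom _ _ (kerbim hrho M) (hombim B M) 0 ker_hom.
Proof.
split=> [x y|r x|r x|d x hx].
- by apply: (can_inj hom_kerK); rewrite (bihomD hom_kerP) !ker_homK.
- by apply: (can_inj hom_kerK); rewrite (bihomL hom_kerP) !ker_homK.
- by apply: (can_inj hom_kerK); rewrite (bihomR hom_kerP) !ker_homK.
rewrite /= addr0; apply/bihom_shiftl/bihom_shiftl; rewrite opprK addrK.
by apply: extend_one_bihom => //; apply: ker_central.
Qed.

End Component.

(** If commuting with the single element rho of S already forces commuting with
    all of S, the kernel functor of rho is represented by R (x)_S R. *)
Definition ker_hom_iso : nat_iso P (ker_functor hrho) (hom_functor B).
Proof.
apply: (@NatIso _ _ P (ker_functor hrho) (hom_functor B)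
  (fun M PM => GHom (ker_homP PM))).
  move=> M PM; exists (GHom (@hom_kerP M)); split.
    exact: ker_homK.
  exact: hom_kerK.
move=> M N PM PN f x; apply: homs_inj => t /=.
by rewrite extend_one_map //; apply: ker_central.
Defined.

End Representing.
End Bimodules.

(** * Soergel bimodules *)

Section SoergelBimodules.
Variables (k : comUnitRingType) (V : vectType k).
Variables (root : gen -> 'Hom(V, k^o)) (coroot : gen -> V).

(** Invariants of both reflections lie in each ring R^u over which the tensor
    products B_u are taken, hence act symmetrically on the generators; this
    property passes to tensor products, sums, shifts and summands. *)
Lemma SBim_invariant_symmetric I M r : SBim root coroot I M ->
  (forall u, sym_refl root coroot u r = r) -> symmetric_scalar M r.
Proof.
move=> hM r_inv.
have Rbim_sym : symmetric_scalar (@Rbim k (dim V)) r.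
  by move=> x; apply: mulrC.
elim: hM => {M}[|u _|M N _ hM _ hN|M N _ hM _ hN|M j _ hM|M N i p ipK _ hM] //.
- have sym_u := symmetric_scalar_tensor (hS := Rinv_const root coroot u)
    Rbim_sym Rbim_sym (r_inv u).
  exact: sym_u.
- exact: symmetric_scalar_tensor.
- by move=> [x y]; congr pair; [apply: hM | apply: hN].
- move=> x; apply: (can_inj ipK).
  by rewrite (bihomL (ghomP i)) (bihomR (ghomP i)) hM.
Qed.

End SoergelBimodules.

Theorem corollary3p5 (m : nat) (k : comUnitRingType) (V : vectType k)
    (root : gen -> 'Hom(V, k^o)) (coroot : gen -> V) (q : k)
    (rho : gen -> 'Hom(V, k^o)) :
  (2 <= m)%N ->
  char_zero k ->
  symmetric_realization root coroot m q ->
  lin_indep2 (root gs) (root gt) ->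
  fundamental_weights coroot rho ->
  (forall j : nat, (1 <= j < m)%N -> qnum q j \is a GRing.unit) ->
  (2 * m).-primitive_root q ->
  let W : gen -> Prop := fun=> True in
  let B_t := Bbim root coroot gt in
  SBim root coroot W (shift B_t (-1)) /\
  inhabited (nat_iso (SBim root coroot W) (pi_minus (rho gs))
                     (hom_functor (shift B_t (-1)))) /\
  exists theta : nat_iso (SBim root coroot W)
                         (hom_functor (shift B_t (-1)))
                         (shift_functor 1 (hom_functor B_t)),
    forall M (hM : SBim root coroot W M) (f : homs (shift B_t (-1)) M) (x : B_t),
      (nat_comp theta hM f : homs B_t M) x = f x.
Proof.
move=> _ _ [root_coroot cartan_sym _ _ _ _ _] indep rhoP _ _ W B_t.
split; first by apply: SBim_shift; apply: SBim_gen.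
have root_regular a : a *: root gt = 0 -> a = 0.
  by move=> a0; have [] := indep 0 a _; rewrite ?scale0r ?add0r.
have rho_inv : Rinv root coroot gt (symV (rho gs)).
  by rewrite /= (refl_rho root rhoP) scale0r subr0.
have rho_central M : SBim root coroot W M -> forall x : M,
    symV (rho gs) *: x = ract x (symV (rho gs)) ->
    central (Rinv root coroot gt) x.
  move=> hM x x_rho r r_inv.
  apply: (invariants_generated root_coroot cartan_sym rhoP root_regular
    (commutant_subalgebra x)) r_inv => // r' r'_inv.
  exact: SBim_invariant_symmetric hM r'_inv x.
split.
  exact: (inhabits (ker_hom_iso (Rinv_const root coroot gt)
    (@symV_deg _ _ (rho gs)) rho_inv rho_central 1)).
by exists (hom_shift_iso (SBim root coroot W) B_t 1).
Qed.
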